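(* The category $\mathbf{qPOS}$ is monoidal closed with respect to the monoidal product $\times$, i.e., for each pair of quantum posets $(\mathcal Y,S)$ and $(\mathcal Z,T)$, there exist a quantum poset $([\mathcal Y,\mathcal Z]_{\sqsubseteq},Q)$ and a monotone function $\mathrm{Eval}_{\sqsubseteq}\colon([\mathcal Y,\mathcal Z]_{\sqsubseteq}\times\mathcal Y,Q\times S)\to(\mathcal Z,T)$ such that for each quantum poset $(\mathcal X,R)$ and each monotone function $F\colon(\mathcal X\times\mathcal Y,R\times S)\to(\mathcal Z,T)$ there is a unique monotone function $G\colon(\mathcal X,R)\to([\mathcal Y,\mathcal Z]_{\sqsubseteq},Q)$ satisfying $\mathrm{Eval}_{\sqsubseteq}\circ(G\times I_{\mathcal Y})=F$. Furthermore, $[\mathcal Y,\mathcal Z]_{\sqsubseteq}$ is the largest subset of $\mathcal Z^{\mathcal Y}$ such that the evaluation function restricted to $[\mathcal Y,\mathcal Z]_{\sqsubseteq}\times\mathcal Y$ is a monotone function $([\mathcal Y,\mathcal Z]_{\sqsubseteq}\times\mathcal Y,I\times S)\to(\mathcal Z,T)$ (where $I=I_{[\mathcal Y,\mathcal Z]_{\sqsubseteq}}$), and $Q$ is the largest binary relation on $[\mathcal Y,\mathcal Z]_{\sqsubseteq}$ such that $$\mathrm{Eval}_{\sqsubseteq}\circ(Q\times S)\le T\circ\mathrm{Eval}_{\sqsubseteq}.$$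
   Context: A quantum set $\mathcal X$ is a set $\mathrm{At}(\mathcal X)$ of nonzero finite-dimensional complex Hilbert spaces, called its atoms. $L(X,Y)$ is the space of linear operators $X\to Y$. A binary relation $R$ from $\mathcal X$ to $\mathcal Y$ is a choice of subspaces $R(X,Y)\subseteq L(X,Y)$, one for each atom $X$ of $\mathcal X$ and each atom $Y$ of $\mathcal Y$; a binary relation on $\mathcal X$ is one from $\mathcal X$ to $\mathcal X$. Composition: $(S\circ R)(X,Z)=\sum_{Y} S(Y,Z)\cdot R(X,Y)$, the sum over atoms $Y$ of $\mathcal Y$, where $V\cdot W$ is the span of the products $vw$. Adjoint: $R^\dagger(Y,X)=\{r^\dagger: r\in R(X,Y)\}$. Identity: $I_{\mathcal X}(X,X)=\mathbb C 1_X$, all other components zero. Order and meet are componentwise ($\subseteq$ and $\cap$). A function $F\colon\mathcal X\to\mathcal Y$ is a binary relation with $F^\dagger\circ F\ge I_{\mathcal X}$ and $F\circ F^\dagger\le I_{\mathcal Y}$; quantum sets and functions form the category $\mathbf{qSet}$. A quantum poset $(\mathcal X,R)$ is a quantum set with a binary relation $R$ on it such that $I_{\mathcal X}\le R$, $R\circ R\le R$, $R\wedge R^\dagger=I_{\mathcal X}$. A function $F\colon\mathcal X\to\mathcal Y$ is monotone $(\mathcal X,R)\to(\mathcal Y,S)$ if $F\circ R\le S\circ F$. $\mathbf{qPOS}$ is the category of quantum posets and monotone functions. The Cartesian product $\mathcal X\times\mathcal Y$ has one atom $X\otimes Y$ for each pair of atoms, and $(R\times S)(X_1\otimes X_2,Y_1\otimes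 Y_2)=R(X_1,Y_1)\otimes S(X_2,Y_2)$. The monoidal product on $\mathbf{qPOS}$ is $(\mathcal X,R)\times(\mathcal Y,S)=(\mathcal X\times\mathcal Y,R\times S)$, with unit $(\mathbf 1,I_{\mathbf 1})$, where $\mathbf 1$ is the quantum set whose only atom is $\mathbb C$. The symmetric monoidal category $(\mathbf{qSet},\times,\mathbf 1)$ is closed (known): for quantum sets $\mathcal Y,\mathcal Z$ there are a quantum set $\mathcal Z^{\mathcal Y}$ and a function $\mathrm{Eval}\colon\mathcal Z^{\mathcal Y}\times\mathcal Y\to\mathcal Z$ such that each function $F\colon\mathcal X\times\mathcal Y\to\mathcal Z$ equals $\mathrm{Eval}\circ(G\times I_{\mathcal Y})$ for a unique function $G\colon\mathcal X\to\mathcal Z^{\mathcal Y}$. $\mathcal W$ is a subset of $\mathcal V$ ($\mathcal W\subseteq\mathcal V$) if every atom of $\mathcal W$ is an atom of $\mathcal V$; the inclusion function $J_{\mathcal W}\colon\mathcal W\to\mathcal V$ has $J_{\mathcal W}(W,W)=\mathbb C1_W$ and all other components zero. For $\mathcal W\subseteq\mathcal Z^{\mathcal Y}$, the restriction of evaluation to $\mathcal W\times\mathcal Y$ is $\mathrm{Eval}\circ(J_{\mathcal W}\times I_{\mathcal Y})$, and $\mathrm{Eval}_{\sqsubseteq}$ is this restriction for $\mathcal W=[\mathcal Y,\mathcal Z]_{\sqsubseteq}$. *)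

(* Defs.v *)
From HB Require Import structures.
From mathcomp Require Import all_boot all_order all_algebra.
From mathcomp Require Import sesquilinear.
From mathcomp Require Import boolp classical_sets.

Set Implicit Arguments.
Unset Strict Implicit.
Unset Printing Implicit Defensive.

Import Order.TTheory GRing.Theory Num.Theory.
Local Open Scope ring_scope.

Section Span.
Variables (K : fieldType) (V : vectType K).

Lemma vspan_subproof (P : set V) : exists U : {vspace V},
  (forall v, P v -> v \in U) /\
  (forall U' : {vspace V}, (forall v, P v -> v \in U') -> (U <= U')%VS).
Proof.
have [n] := ubnP (\dim {: V}).
have : forall v, P v -> v \in {: V}%VS by move=> v _; exact: memvf.
move: (fullv : {vspace V}) => U; elim: n U => // n IHn U PU dimU.
have [[U' PU' nUU']|nU] := pselect (exists2 U' : {vspace V},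
    (forall v, P v -> v \in U') & ~~ (U <= U')%VS); last first.
  by exists U; split=> // U' PU'; apply/negPn/negP => nUU'; apply: nU; exists U'.
apply: (IHn (U :&: U')%VS) => [v Pv|]; first by rewrite memv_cap PU ?PU'.
have le_dim := dimvS (capvSl U U').
suff: (\dim (U :&: U')%VS < \dim U)%N by move/leq_trans; apply.
rewrite ltn_neqAle le_dim andbT; apply: contra nUU' => /eqP eq_dim.
have /eqP <- : (U :&: U')%VS == U by rewrite eqEdim capvSl eq_dim /=.
exact: capvSr.
Qed.

Definition vspan (P : set V) : {vspace V} := projT1 (cid (vspan_subproof P)).

Lemma mem_vspan (P : set V) v : P v -> v \in vspan P.
Proof. by rewrite /vspan; case: cid => U [PU _] /= /PU. Qed.

Lemma vspan_min (P : set V) (U : {vspace V}) :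
  (forall v, P v -> v \in U) -> (vspan P <= U)%VS.
Proof. by rewrite /vspan; case: cid => W [_ minW] /= /minW. Qed.

Definition vsum (I : Type) (U : I -> {vspace V}) : {vspace V} :=
  vspan [set v | exists i, v \in U i].

End Span.

Section QuantumSets.
Variable C : numClosedFieldType.

(* Nonzero finite-dimensional Hilbert spaces over C, which is to be R[i] for  *)
(* R : realType. The inner product is linear in its first argument and        *)
(* conjugate-linear in the second one.                                        *)
Record hilb := Hilb {
  hsort :> vectType C;
  hdot : {dot hsort for Num.conj};
  hilb_neq0 : (0 < dim hsort)%N
}.

Section OrthonormalBasis.
Variable X : hilb.

Lemma onb_subproof : exists e : 'I_(dim X) -> X,
  forall i j, hdot X (e i) (e j) = (i == j)%:R.
Proof.
suff [s [os sS]] : exists s : seq X, orthonormal (hdot X) s /\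
    (<<s>> = {: X})%VS.
  have fs : free s := orthonormal_free os.
  have ss : size s = dim X by rewrite -dimvf -sS; apply/esym/eqP.
  exists (fun i => s`_i) => i j.
  have [us /(_ s`_i s`_j)->] := orthonormalP os; rewrite ?mem_nth ?ss //.
  by rewrite nth_uniq ?ss.
have := span_basis (vbasisP {: X}); move: (tval _) => s <-.
elim: s => [|v s [t [ot tS]]]; first by exists nil.
have [x tx [y [vE _ oyt]]] := orthogonal_split (hdot X) t v.
have [y0|y0] := eqVneq y 0.
  exists t; split=> //; rewrite span_cons -tS.
  by apply/esym/addv_idPr; rewrite -memvE vE y0 addr0.
pose c := sqrtC (hdot X y y).
have c0 : c != 0 by rewrite sqrtC_eq0 dnorm_eq0.
have cge0 : 0 <= c by rewrite sqrtC_ge0 dnorm_ge0.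
exists (c^-1 *: y :: t); split; last first.
  rewrite !span_cons -tS; apply/eqP; rewrite eqEsubv !subv_add !addvSr !andbT.
  rewrite -!memvE; apply/andP; split.
    have -> : c^-1 *: y = c^-1 *: v - c^-1 *: x by rewrite vE scalerDr addrC addKr.
    rewrite memvB // memvZ //; first by apply: (subvP (addvSl _ _)); exact: memv_line.
    exact: (subvP (addvSr _ _)).
  rewrite vE addrC memv_add // -[y in X in X \in _](scalerKV c0) memvZ //.
  exact: memv_line.
rewrite (_ : _ :: t = [:: c^-1 *: y] ++ t) // orthonormal_cat ot /=.
apply/andP; split.
  rewrite /orthonormal /= !andbT dnormZ normfV (ger0_norm cge0) exprVn.
  by rewrite sqrtCK mulVf // dnorm_eq0.
apply/orthoPl => z zt; rewrite linearZl_LR /=.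
by have /orthoPl/(_ z zt)-> := oyt; rewrite mulr0.
Qed.

(* A fixed orthonormal basis, used only to define tensor products. *)
Definition onb : 'I_(dim X) -> X := projT1 (cid onb_subproof).

Lemma onbE i j : hdot X (onb i) (onb j) = (i == j)%:R.
Proof. by rewrite /onb; case: cid. Qed.

End OrthonormalBasis.
Arguments onb : clear implicits.

Lemma onb_inj (X : hilb) : injective (onb X).
Proof.
move=> i j eij; have := onbE i j; rewrite eij onbE eqxx.
by case: (eqVneq i j) => // _ /eqP; rewrite oner_eq0.
Qed.

Lemma onb_expand (X : hilb) (x : X) : x = \sum_i hdot X x (onb X i) *: onb X i.
Proof.
pose e := [tuple onb X i | i < dim X].
have eE (i : 'I_(dim X)) : e`_i = onb X i by rewrite -tnth_nth tnth_mktuple.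
have : free e.
  apply: (@orthonormal_free _ _ (hdot X)); apply/orthonormalP; split.
    by rewrite map_inj_uniq ?enum_uniq //; apply: onb_inj.
  move=> _ _ /mapP[i _ ->] /mapP[j _ ->].
  by rewrite onbE (inj_eq (@onb_inj X)).
rewrite /free size_tuple => /eqP dim_e.
have /coord_span xE : x \in <<e>>%VS.
  suff /eqP -> : <<e>>%VS == fullv by rewrite memvf.
  by rewrite eqEdim subvf dim_e dimvf /=.
rewrite {1}xE; apply: eq_bigr => i _; rewrite eE; congr (_ *: _).
rewrite {2}xE linear_sumlz (bigD1 i) //= big1 => [|j ji].
  by rewrite addr0 linearZl_LR /= eE onbE eqxx mulr1.
by rewrite linearZl_LR /= eE onbE (negPf ji) mulr0.
Qed.

(* The tensor product X (x) Y is the space of matrices of coordinates along   *)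
(* the products of the basis vectors of X and Y, with its standard inner      *)
(* product; it does not depend, up to unitary maps, on the two bases.         *)
Section Tensor.
Variables m n : nat.

Definition mxdot (M N : 'M[C]_(m, n)) : C :=
  \sum_i \sum_j M i j * (N i j)^*.

Fact mxdot_linearl N : linear_for *%R (mxdot ^~ N).
Proof.
move=> a M M'; rewrite /mxdot mulr_sumr -big_split; apply: eq_bigr => i _ /=.
rewrite mulr_sumr -big_split; apply: eq_bigr => j _ /=.
by rewrite !mxE mulrDl mulrA.
Qed.

Fact mxdot_linearr M : linear_for (Num.conj \; *%R) (mxdot M).
Proof.
move=> a N N'; rewrite /mxdot /= mulr_sumr -big_split; apply: eq_bigr => i _ /=.
rewrite mulr_sumr -big_split; apply: eq_bigr => j _ /=.
by rewrite !mxE rmorphD rmorphM mulrDr mulrCA.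
Qed.

HB.instance Definition _ := bilinear_isBilinear.Build C _ _ _
  ( *%R) (Num.conj \; *%R) mxdot (mxdot_linearl, mxdot_linearr).

Fact mxdot_herm M N : mxdot M N = (-1) ^+ false * (mxdot N M)^*.
Proof.
rewrite mul1r /mxdot rmorph_sum; apply: eq_bigr => i _ /=.
rewrite rmorph_sum; apply: eq_bigr => j _ /=.
by rewrite rmorphM /= conjCK mulrC.
Qed.

HB.instance Definition _ := isHermitianSesquilinear.Build C _ false
  Num.conj mxdot mxdot_herm.

Fact mxdot_gt0 M : M != 0 -> 0 < mxdot M M.
Proof.
have ge0 i j : 0 <= M i j * (M i j)^* by rewrite mul_conjC_ge0.
move=> M0; rewrite lt_def sumr_ge0 ?andbT => [|i _]; last exact: sumr_ge0.
apply: contra M0; rewrite psumr_eq0 => [|i _]; last exact: sumr_ge0.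
move=> /allP M0; apply/eqP/matrixP => i j; rewrite mxE.
have := M0 i (mem_index_enum i); rewrite psumr_eq0 //= => /allP.
by move=> /(_ j (mem_index_enum j)); rewrite /= mul_conjC_eq0 => /eqP.
Qed.

HB.instance Definition _ := isDotProduct.Build C _ mxdot mxdot_gt0.

End Tensor.

Fact tens_neq0 (X Y : hilb) : (0 < dim 'M[C]_(dim X, dim Y))%N.
Proof. by rewrite [X in (0 < X)%N]/dim /= muln_gt0 !hilb_neq0. Qed.

Definition tens (X Y : hilb) : hilb :=
  Hilb (@mxdot (dim X) (dim Y)) (tens_neq0 X Y).

Definition tensv (X Y : hilb) (x : X) (y : Y) : tens X Y :=
  \matrix_(i, j) (hdot X x (onb X i) * hdot Y y (onb Y j)).

Lemma hdotC (X : hilb) (x y : X) : hdot X x y = (hdot X y x)^*.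
Proof. by rewrite (hermC (hdot X)) expr0 mul1r. Qed.

Lemma hdot_suml (X : hilb) n (v : 'I_n -> X) y :
  hdot X (\sum_i v i) y = \sum_i hdot X (v i) y.
Proof.
apply: (big_morph (hdot X ^~ y)) => [u w|]; first by rewrite linearDl.
by rewrite linear0l.
Qed.

Lemma hdot_sumr (X : hilb) n (v : 'I_n -> X) y :
  hdot X y (\sum_i v i) = \sum_i hdot X y (v i).
Proof.
apply: (big_morph (hdot X y)) => [u w|]; first by rewrite linearDr.
by rewrite linear0r.
Qed.

Lemma parseval (X : hilb) (x y : X) :
  hdot X x y = \sum_i hdot X x (onb X i) * (hdot X y (onb X i))^*.
Proof.
rewrite {1}(onb_expand x) hdot_suml; apply: eq_bigr => i _.
by rewrite linearZl_LR /= (hdotC (onb X i) y).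
Qed.

Lemma dot_tensv (X Y : hilb) (x x' : X) (y y' : Y) :
  hdot (tens X Y) (tensv x y) (tensv x' y') = hdot X x x' * hdot Y y y'.
Proof.
rewrite (parseval x) (parseval y) mulr_suml /= /mxdot; apply: eq_bigr => i _.
rewrite mulr_sumr; apply: eq_bigr => j _; rewrite !mxE rmorphM /=.
by rewrite mulrACA.
Qed.

(* The tensor product r (x) s of two operators, given by its values on the    *)
(* basis of the vectors onb i (x) onb j.                                      *)
Definition tensh (X1 X2 Y1 Y2 : hilb) (r : 'Hom(X1, Y1)) (s : 'Hom(X2, Y2)) :
    'Hom(tens X1 X2, tens Y1 Y2) :=
  linfun (fun M : tens X1 X2 => \sum_i \sum_j
    (M : 'M_(_, _)) i j *: tensv (r (onb X1 i)) (s (onb X2 j))).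

Fact tensh_lin (X1 X2 Y1 Y2 : hilb) (r : 'Hom(X1, Y1)) (s : 'Hom(X2, Y2)) :
  linear (fun M : tens X1 X2 => \sum_i \sum_j
    (M : 'M_(_, _)) i j *: tensv (r (onb X1 i)) (s (onb X2 j)) : tens Y1 Y2).
Proof.
move=> a M N; rewrite scaler_sumr -big_split; apply: eq_bigr => i _ /=.
rewrite scaler_sumr -big_split; apply: eq_bigr => j _ /=.
by rewrite !mxE scalerDl scalerA.
Qed.

Lemma tenshE (X1 X2 Y1 Y2 : hilb) (r : 'Hom(X1, Y1)) (s : 'Hom(X2, Y2)) x y :
  tensh r s (tensv x y) = tensv (r x) (s y).
Proof.
pose L := GRing.isLinear.Build _ _ _ _ _ (tensh_lin r s).
pose f : {linear tens X1 X2 -> tens Y1 Y2} :=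
  HB.pack (fun M : tens X1 X2 => \sum_i \sum_j
    (M : 'M_(_, _)) i j *: tensv (r (onb X1 i)) (s (onb X2 j)) : tens Y1 Y2) L.
rewrite /tensh (lfunE f) /=.
apply/matrixP => k l; rewrite summxE [RHS]mxE.
rewrite [X in r X](onb_expand x) [X in s X](onb_expand y).
rewrite !raddf_sum !hdot_suml mulr_suml; apply: eq_bigr => i _ /=.
rewrite summxE mulr_sumr; apply: eq_bigr => j _ /=.
by rewrite !linearZ /= !linearZl_LR /= !mxE mulrACA.
Qed.

Definition is_adjoint (X Y : hilb) (r : 'Hom(X, Y)) (s : 'Hom(Y, X)) :=
  forall x y, hdot Y (r x) y = hdot X x (s y).

Lemma adjoint_exists (X Y : hilb) (r : 'Hom(X, Y)) : exists s, is_adjoint r s.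
Proof.
pose g (y : Y) : X := \sum_i hdot Y y (r (onb X i)) *: onb X i.
have gl : linear g.
  move=> a u v; rewrite scaler_sumr -big_split; apply: eq_bigr => i _ /=.
  by rewrite linearDl linearZl_LR scalerDl scalerA.
pose f : {linear Y -> X} := HB.pack g (GRing.isLinear.Build _ _ _ _ _ gl).
exists (linfun f) => x y; rewrite lfunE /= /g hdot_sumr.
rewrite {1}(onb_expand x) linear_sum hdot_suml; apply: eq_bigr => i _.
by rewrite linearZ /= linearZl_LR linearZr_LR /= -hdotC mulrC.
Qed.

(* A quantum set is given as a family of Hilbert spaces indexed by its type   *)
(* of atoms, rather than as a set of Hilbert spaces, so that the atoms of a   *)
(* product are indexed by pairs even when the tensor products of distinct     *)
(* pairs happen to be equal types.                                            *)
Record qset := QSet { atom : Type; aspace :> atom -> hilb }.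

Definition qrel (X Y : qset) := forall (x : atom X) (y : atom Y),
  {vspace 'Hom(X x, Y y)}.

Definition rle (X Y : qset) (r s : qrel X Y) := forall x y, (r x y <= s x y)%VS.

Definition rmeet (X Y : qset) (r s : qrel X Y) : qrel X Y :=
  fun x y => (r x y :&: s x y)%VS.

Definition prodh (X Y Z : hilb) (V : {vspace 'Hom(Y, Z)})
    (W : {vspace 'Hom(X, Y)}) : {vspace 'Hom(X, Z)} :=
  vspan [set h | exists v w, [/\ v \in V, w \in W & h = (v \o w)%VF]].

Definition rcomp (X Y Z : qset) (s : qrel Y Z) (r : qrel X Y) : qrel X Z :=
  fun x z => vsum (fun y => prodh (s y z) (r x y)).

(* The adjoints of the elements of r x y already form a subspace. *)
Definition radj (X Y : qset) (r : qrel X Y) : qrel Y X :=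
  fun y x => vspan [set h | exists2 f, f \in r x y & is_adjoint f h].

Definition rid (X : qset) : qrel X X := fun x x' =>
  match pselect (x = x') with
  | left e => <[ecast z 'Hom(X x, X z) e \1%VF]>%VS
  | right _ => 0%VS
  end.
Arguments rid : clear implicits.

Definition qfun (X Y : qset) (f : qrel X Y) :=
  rle (rid X) (rcomp (radj f) f) /\ rle (rcomp f (radj f)) (rid Y).

Definition qorder (X : qset) (r : qrel X X) :=
  [/\ rle (rid X) r, rle (rcomp r r) r & rmeet r (radj r) = rid X].

Definition monotone (X Y : qset) (r : qrel X X) (s : qrel Y Y) (f : qrel X Y) :=
  qfun f /\ rle (rcomp f r) (rcomp s f).

Definition qprod (X Y : qset) : qset :=
  QSet (fun a : atom X * atom Y => tens (X a.1) (Y a.2)).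

Definition rprod (X1 X2 Y1 Y2 : qset) (r : qrel X1 Y1) (s : qrel X2 Y2) :
    qrel (qprod X1 X2) (qprod Y1 Y2) :=
  fun x y => vspan [set h | exists f g,
    [/\ f \in r x.1 y.1, g \in s x.2 y.2 & h = tensh f g]].

(* The universal property of (Z^Y, Eval) in the category of quantum sets. *)
Definition is_exponential (Y Z E : qset) (ev : qrel (qprod E Y) Z) :=
  qfun ev /\
  forall (X : qset) (f : qrel (qprod X Y) Z), qfun f ->
    exists! g : qrel X E, qfun g /\ f = rcomp ev (rprod g (rid Y)).

Definition qsub (V : qset) (W : set (atom V)) : qset :=
  QSet (fun w : {a : atom V | W a} => V (sval w)).

Definition qincl (V : qset) (W : set (atom V)) : qrel (qsub W) V :=
  fun w v => rid V (sval w) v.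
Arguments qincl : clear implicits.

Definition ev_restr (Y Z E : qset) (ev : qrel (qprod E Y) Z)
    (W : set (atom E)) : qrel (qprod (qsub W) Y) Z :=
  rcomp ev (rprod (qincl E W) (rid Y)).

End QuantumSets.

Arguments onb {C} X.
Arguments rid {C} X.
Arguments qincl {C V} W.
Arguments ev_restr {C Y Z E} ev W.

(* Main.v *)
From HB Require Import structures.
Require Import Defs.
From mathcomp Require Import all_boot all_order all_algebra.
From mathcomp Require Import sesquilinear.
From mathcomp Require Import boolp classical_sets reals.
From mathcomp Require Import complex.

Set Implicit Arguments.
Unset Strict Implicit.
Unset Printing Implicit Defensive.

Import Order.TTheory GRing.Theory Num.Theory.

(** Binary relations between quantum sets form an ordered category with an
involution, and almost everything can be computed there without looking at
operators. A function f satisfies f r <= s iff r <= f^+ s, and r f^+ <= s iff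
r <= s f ([qfun_shiftl], [qfun_shiftr]); in particular two comparable functions
are equal ([qfun_le_eq]). Products have a residual: there is a largest G with
G x S <= U ([tres], [tresP]).

The poset exponential. Let Eval be the evaluation of an exponential E of Z by Y
in qSet, and let N be the largest relation on E with
Eval (N x S) <= T Eval ([pointwise]). It is transitive. It is also
antisymmetric: N meet N^+ consists of relations G with Eval (G x I) <= Eval, and
the universal property of E forces these to lie below the identity
([qhom_exponential]). N may fail to be reflexive; W is the set of atoms at which
it is ([monotone_points]), and if J is the inclusion of W, then Q = J^+ N J is an
order on W. A subset W' of E has a monotone restricted evaluation iff N is
reflexive at all its atoms ([ev_restr_monotone]), so W is the largest such
subset, and Q is the largest relation by the definition of N ([ev_restr_le]).
A monotone F is Eval (G0 x I) for a unique function G0 into E. Monotonicity of F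
says exactly that G0 P G0^+ <= N ([transpose_pointwise]). As P is reflexive,
this makes N reflexive at each atom that G0 meets, so G0 factors through W
([transpose_corestrict]), and the factor is monotone.

The exponential of quantum sets. For functions F from X x Y and F' from X' x Y
to Z, the largest G from X to X' with F' (G x I) <= F is the relation of
intertwiners ([qhom]): these compose, and the adjoint of an intertwiner is one.
If X has a single atom H, then F is a representation on H and its
intertwiners form a *-algebra of operators on H. When this algebra is not C1, it
contains a nontrivial projection ([nontrivial_projection]), which splits off a
subrepresentation; hence every representation decomposes into irreducible ones
([complete_reducibility]). The atoms of E are representatives of the irreducible
representations up to unitary equivalence. By the lemma of Schur the
intertwiners from Eval to itself form the identity relation ([qhom_eval]), and
together with complete reducibility this says that the intertwiners from F to
Eval are a function, namely the one that transposes F ([eval_exponential]). *)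

(** * Spans and induction *)

Section SpanInduction.
Local Open Scope ring_scope.
Variables (K : fieldType) (V : vectType K).

(** A subspace of maximal dimension inside a predicate closed under linear
combinations exhausts it. *)
Lemma closed_vspace (D : set V) : D 0 ->
  (forall a u v, D u -> D v -> D (a *: u + v)) ->
  exists U : {vspace V}, forall v, v \in U <-> D v.
Proof.
move=> D0 DP.
suff [U [UD maxU]] : exists U : {vspace V}, (forall v, v \in U -> D v) /\
    (forall v, D v -> v \in U) by exists U => v; split; [exact: UD|exact: maxU].
have [n] := ubnP (\dim {: V} - \dim (0%VS : {vspace V})).
have : forall v : V, v \in 0%VS -> D v by move=> v; rewrite memv0 => /eqP->.
move: (0%VS : {vspace V}) => U; elim: n U => // n IHn U UD dimU.
have [[v Dv nUv]|nU] := pselect (exists2 v, D v & v \notin U); last first.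
  exists U; split=> // v Dv; apply/negPn/negP => nUv; apply: nU; by exists v.
apply: (IHn (U + <[v]>)%VS) => [w /memv_addP[u Uu [_ /vlineP[a ->] ->]]|].
  by rewrite addrC; apply: DP => //; apply: UD.
have ltU : (\dim U < \dim (U + <[v]>)%VS)%N.
  rewrite ltn_neqAle dimvS ?addvSl // andbT.
  apply: contra nUv => /eqP eqU.
  have /eqP -> : U == (U + <[v]>)%VS by rewrite eqEdim addvSl eqU /=.
  by apply: (subvP (addvSr _ _)); exact: memv_line.
have leU := dimvS (subvf (U + <[v]>)%VS).
rewrite ltnS in dimU; apply: leq_trans dimU.
by apply: ltn_sub2l => //; exact: leq_trans ltU leU.
Qed.

(** Spans are given by minimality among subspaces only; this is the induction
principle through which all compositions, adjoints and products of relations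
are analysed. It also covers conjugate-linear conditions. *)
Lemma vspan_ind (P D : set V) : D 0 ->
  (forall a u v, D u -> D v -> D (a *: u + v)) ->
  (forall v, P v -> D v) -> forall v, v \in vspan P -> D v.
Proof.
move=> D0 /(closed_vspace D0)[U UD] PD v Pv; apply/UD; apply: subvP v Pv.
by apply: vspan_min => v /PD /UD.
Qed.

Lemma vspan_id (D : set V) : D 0 ->
  (forall a u v, D u -> D v -> D (a *: u + v)) ->
  forall v, v \in vspan D <-> D v.
Proof. by move=> D0 DP v; split; [exact: vspan_ind|exact: mem_vspan]. Qed.

End SpanInduction.

(** * Adjoints and tensor products of operators *)

Section Operators.
Local Open Scope ring_scope.
Variable C : numClosedFieldType.
Implicit Types X Y Z : hilb C.

Lemma hdot_inj X (x y : X) : (forall z, hdot X z x = hdot X z y) -> x = y.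
Proof.
move=> xy; apply/eqP; rewrite -subr_eq0 -(dnorm_eq0 (hdot X)).
by rewrite linearBr /= xy subrr.
Qed.

Definition dag X Y (r : 'Hom(X, Y)) : 'Hom(Y, X) := projT1 (cid (adjoint_exists r)).

Lemma dagP X Y (r : 'Hom(X, Y)) : is_adjoint r (dag r).
Proof. by rewrite /dag; case: cid. Qed.

Lemma dag_uniq X Y (r : 'Hom(X, Y)) s : is_adjoint r s -> s = dag r.
Proof.
move=> rs; apply/lfunP => y; apply: hdot_inj => x.
by rewrite -rs -dagP.
Qed.

Lemma dagK X Y (r : 'Hom(X, Y)) : dag (dag r) = r.
Proof.
apply/esym/dag_uniq => y x; rewrite hdotC -(dagP r x y); exact/esym/hdotC.
Qed.

Lemma dag_comp X Y Z (s : 'Hom(Y, Z)) (r : 'Hom(X, Y)) :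
  dag (s \o r)%VF = (dag r \o dag s)%VF.
Proof. by apply/esym/dag_uniq => x z; rewrite !comp_lfunE !dagP. Qed.

Lemma dag1 X : dag \1%VF = \1%VF :> 'End(X).
Proof. by apply/esym/dag_uniq => x y; rewrite !id_lfunE. Qed.

Lemma dagD X Y (r s : 'Hom(X, Y)) : dag (r + s) = dag r + dag s.
Proof.
by apply/esym/dag_uniq => x y; rewrite !add_lfunE linearDl linearDr /= !dagP.
Qed.

Lemma dagZ X Y a (r : 'Hom(X, Y)) : dag (a *: r) = a^* *: dag r.
Proof.
apply/esym/dag_uniq => x y.
by rewrite !scale_lfunE linearZl_LR linearZr_LR /= conjCK !dagP.
Qed.

Lemma dag0 X Y : dag (0 : 'Hom(X, Y)) = 0.
Proof. by rewrite -(scale0r 0) dagZ conjC0 scale0r. Qed.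

Lemma dag_comp_eq0 X Y (r : 'Hom(X, Y)) x : dag r (r x) = 0 -> r x = 0.
Proof.
move=> r0; apply/eqP; rewrite -(dnorm_eq0 (hdot Y)).
by rewrite dagP r0 linear0r.
Qed.

Section TensorVectors.
Variables X Y : hilb C.

Lemma tensv_onb i j : tensv (onb X i) (onb Y j) = delta_mx i j :> 'M_(_, _).
Proof.
by apply/matrixP => k l; rewrite !mxE !onbE -natrM mulnb (eq_sym i) (eq_sym j).
Qed.

Lemma tens_ext (Z : vectType C) (f g : 'Hom(tens X Y, Z)) :
  (forall x y, f (tensv x y) = g (tensv x y)) -> f = g.
Proof.
move=> fg; apply/lfunP => M; rewrite (matrix_sum_delta (M : 'M_(_, _))).
rewrite !linear_sum; apply: eq_bigr => i _; rewrite !linear_sum.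
apply: eq_bigr => j _.
by rewrite !linearZ /= -tensv_onb fg.
Qed.

End TensorVectors.

Lemma tensvPl X Y a (x x' : X) (y : Y) :
  tensv (a *: x + x') y = a *: tensv x y + tensv x' y.
Proof.
by apply/matrixP => i j; rewrite !mxE linearDl linearZl_LR /= mulrDl mulrA.
Qed.

Lemma tensvPr X Y a (x : X) (y y' : Y) :
  tensv x (a *: y + y') = a *: tensv x y + tensv x y'.
Proof.
by apply/matrixP => i j; rewrite !mxE linearDl linearZl_LR /= mulrDr mulrCA.
Qed.

Section TensorOperators.
Variables X1 X2 Y1 Y2 : hilb C.
Implicit Types (r : 'Hom(X1, Y1)) (s : 'Hom(X2, Y2)).

Lemma tenshPl a r r' s :
  tensh (a *: r + r') s = a *: tensh r s + tensh r' s.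
Proof.
apply: tens_ext => x y; rewrite add_lfunE scale_lfunE !tenshE.
by rewrite add_lfunE scale_lfunE tensvPl.
Qed.

Lemma tenshPr a r s s' :
  tensh r (a *: s + s') = a *: tensh r s + tensh r s'.
Proof.
apply: tens_ext => x y; rewrite add_lfunE scale_lfunE !tenshE.
by rewrite add_lfunE scale_lfunE tensvPr.
Qed.

Lemma tensh0l s : tensh (0 : 'Hom(X1, Y1)) s = 0.
Proof.
have := tenshPl (-1) 0 0 s; rewrite scaler0 add0r => ->.
by rewrite scaleN1r addNr.
Qed.

Lemma tensh0r r : tensh r (0 : 'Hom(X2, Y2)) = 0.
Proof.
have := tenshPr (-1) r 0 0; rewrite scaler0 add0r => ->.
by rewrite scaleN1r addNr.
Qed.

Lemma tenshZl a r s : tensh (a *: r) s = a *: tensh r s.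
Proof. by have := tenshPl a r 0 s; rewrite tensh0l !addr0. Qed.

Lemma tenshZr a r s : tensh r (a *: s) = a *: tensh r s.
Proof. by have := tenshPr a r s 0; rewrite tensh0r !addr0. Qed.

Lemma tensv_dense (M N : tens Y1 Y2) :
  (forall x y, hdot _ (tensv x y) M = hdot _ (tensv x y) N) -> M = N.
Proof.
move=> MN; apply: hdot_inj => P; rewrite (matrix_sum_delta (P : 'M_(_, _))).
rewrite !linear_sumlz; apply: eq_bigr => i _; rewrite !linear_sumlz.
apply: eq_bigr => j _.
by rewrite !linearZl_LR /= -tensv_onb MN.
Qed.

End TensorOperators.

Lemma tensh_comp X1 X2 Y1 Y2 Z1 Z2 (r : 'Hom(X1, Y1)) (s : 'Hom(X2, Y2))
    (r' : 'Hom(Y1, Z1)) (s' : 'Hom(Y2, Z2)) :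
  tensh (r' \o r) (s' \o s) = (tensh r' s' \o tensh r s)%VF.
Proof. by apply: tens_ext => x y; rewrite comp_lfunE !tenshE !comp_lfunE. Qed.

Lemma tensh1 X Y : tensh \1 \1 = \1%VF :> 'End(tens X Y).
Proof. by apply: tens_ext => x y; rewrite tenshE !id_lfunE. Qed.

Lemma dag_tensh X1 X2 Y1 Y2 (r : 'Hom(X1, Y1)) (s : 'Hom(X2, Y2)) :
  dag (tensh r s) = tensh (dag r) (dag s).
Proof.
apply: tens_ext => x y; apply: tensv_dense => x' y'.
by rewrite -dagP !tenshE !dot_tensv !dagP.
Qed.

End Operators.

(** * The ordered category of relations *)

Section Relations.
Local Open Scope ring_scope.
Variable C : numClosedFieldType.

Section Components.
Implicit Types X Y Z : qset C.

Lemma rle_refl X Y (r : qrel X Y) : rle r r.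
Proof. by move=> x y. Qed.

Lemma rle_trans X Y (s r t : qrel X Y) : rle r s -> rle s t -> rle r t.
Proof. by move=> rs st x y; apply: subv_trans (rs x y) (st x y). Qed.

Lemma rle_anti X Y (r s : qrel X Y) : rle r s -> rle s r -> r = s.
Proof.
move=> rs sr; apply: functional_extensionality_dep => x.
apply: functional_extensionality_dep => y; apply/eqP.
by rewrite eqEsubv rs sr.
Qed.

Lemma mem_rcomp X Y Z (s : qrel Y Z) (r : qrel X Y) x y z v w :
  v \in s y z -> w \in r x y -> (v \o w)%VF \in rcomp s r x z.
Proof.
by move=> sv rw; apply: mem_vspan; exists y; apply: mem_vspan; exists v, w.
Qed.

Lemma rcomp_ind X Y Z (s : qrel Y Z) (r : qrel X Y) x z
    (D : set 'Hom(X x, Z z)) :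
  D 0 -> (forall a u v, D u -> D v -> D (a *: u + v)) ->
  (forall y v w, v \in s y z -> w \in r x y -> D (v \o w)%VF) ->
  forall u, u \in rcomp s r x z -> D u.
Proof.
move=> D0 DP sr; apply: vspan_ind => // u [y].
apply: vspan_ind => // _ [v [w [sv rw ->]]].
exact: sr sv rw.
Qed.

Lemma rcomp_le X Y Z (s : qrel Y Z) (r : qrel X Y) (t : qrel X Z) :
  (forall x y z v w, v \in s y z -> w \in r x y -> (v \o w)%VF \in t x z) ->
  rle (rcomp s r) t.
Proof.
move=> srt x z; apply/subvP; apply: rcomp_ind; first exact: mem0v.
  by move=> a u v tu tv; rewrite rpredD ?rpredZ.
by move=> y v w; exact: srt.
Qed.

Lemma rcompS X Y Z (s s' : qrel Y Z) (r r' : qrel X Y) :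
  rle s s' -> rle r r' -> rle (rcomp s r) (rcomp s' r').
Proof.
move=> ss rr; apply: rcomp_le => x y z v w sv rw.
by apply: (@mem_rcomp _ _ _ _ _ _ y); [exact: (subvP (ss _ _))|];
  exact: (subvP (rr _ _)).
Qed.

Lemma rcompSl X Y Z (s s' : qrel Y Z) (r : qrel X Y) :
  rle s s' -> rle (rcomp s r) (rcomp s' r).
Proof. by move=> ss; apply: rcompS => //; exact: rle_refl. Qed.

Lemma rcompSr X Y Z (s : qrel Y Z) (r r' : qrel X Y) :
  rle r r' -> rle (rcomp s r) (rcomp s r').
Proof. by apply: rcompS; exact: rle_refl. Qed.

Lemma rcompA X Y Z W (t : qrel Z W) (s : qrel Y Z) (r : qrel X Y) :
  rcomp t (rcomp s r) = rcomp (rcomp t s) r.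
Proof.
apply: rle_anti; apply: rcomp_le.
  move=> x z w u v tu; move: v; apply: rcomp_ind.
  - by rewrite comp_lfun0r mem0v.
  - move=> a v v' Dv Dv'.
    by rewrite comp_lfunDr -comp_lfunZr rpredD ?rpredZ.
  by move=> y v v' sv rv'; rewrite comp_lfunA; do !apply: mem_rcomp.
move=> x y w u v + rv; move: u; apply: rcomp_ind.
- by rewrite comp_lfun0l mem0v.
- move=> a u u' Du Du'.
  by rewrite comp_lfunDl -comp_lfunZl rpredD ?rpredZ.
by move=> z u u' tu su'; rewrite -comp_lfunA; do !apply: mem_rcomp.
Qed.

Lemma rid_refl X (x : atom X) : rid X x x = <[\1%VF]>%VS.
Proof.
by rewrite /rid; case: pselect => // e; rewrite (Prop_irrelevance e erefl).
Qed.

Lemma mem_rid1 X (x : atom X) : \1%VF \in rid X x x.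
Proof. by rewrite rid_refl memv_line. Qed.

Lemma rid_neq X (x x' : atom X) : x <> x' -> rid X x x' = 0%VS.
Proof. by rewrite /rid; case: pselect. Qed.

(** The type of v depends on x', so a case analysis on x = x' is awkward inside a
proof; this principle does it once. *)
Lemma rid_ind X (x : atom X) (D : forall x', 'Hom(X x, X x') -> Prop) :
  (forall x', D x' 0) -> (forall a, D x (a *: \1%VF)) ->
  forall x' v, v \in rid X x x' -> D x' v.
Proof.
move=> D0 D1 x'; have [<- v|/rid_neq-> v] := pselect (x = x').
  by rewrite rid_refl => /vlineP[a ->].
by rewrite memv0 => /eqP ->.
Qed.

Lemma rcomp1l X Y (r : qrel X Y) : rcomp (rid Y) r = r.
Proof.
apply: rle_anti; last first.
  move=> x y; apply/subvP => v rv; rewrite -(comp_lfun1l v).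
  by apply: mem_rcomp rv; exact: mem_rid1.
apply: rcomp_le => x y z v w + rw; move: z v; apply: rid_ind => [z|a].
  by rewrite comp_lfun0l mem0v.
by rewrite -comp_lfunZl comp_lfun1l rpredZ.
Qed.

Lemma mem_radj X Y (r : qrel X Y) x y h :
  (h \in radj r y x) = (dag h \in r x y).
Proof.
apply/idP/idP => [|rh]; last first.
  apply: mem_vspan; exists (dag h) => // u v.
  by rewrite dagP dagK.
move: h; apply: vspan_ind => [|a u v ru rv|h [f rf /dag_uniq ->]].
- by rewrite dag0 mem0v.
- by rewrite dagD dagZ rpredD ?rpredZ.
- by rewrite dagK.
Qed.

Lemma radjK X Y (r : qrel X Y) : radj (radj r) = r.
Proof.
by apply: rle_anti => x y; apply/subvP => h; rewrite !mem_radj dagK.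
Qed.

Lemma radjS X Y (r s : qrel X Y) : rle r s -> rle (radj r) (radj s).
Proof.
move=> rs y x; apply/subvP => h; rewrite !mem_radj; exact: (subvP (rs _ _)).
Qed.

Lemma radj_le X Y (r : qrel X Y) s : rle (radj r) s <-> rle r (radj s).
Proof. by split=> /radjS; rewrite radjK. Qed.

Lemma radj_comp X Y Z (s : qrel Y Z) (r : qrel X Y) :
  radj (rcomp s r) = rcomp (radj r) (radj s).
Proof.
suff le X' Y' Z' (s' : qrel Y' Z') (r' : qrel X' Y') :
    rle (rcomp (radj r') (radj s')) (radj (rcomp s' r')).
  apply: rle_anti => //; apply/radj_le.
  by rewrite -{1}(radjK s) -{1}(radjK r); exact: le.
apply: rcomp_le => z y x v w; rewrite !mem_radj dag_comp => rv sw.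
exact: mem_rcomp sw rv.
Qed.

Lemma radj1 X : radj (rid X) = rid X.
Proof.
suff le : rle (rid X) (radj (rid X)) by apply: rle_anti => //; exact/radj_le.
move=> x y; apply/subvP; move: y; apply: rid_ind => [y|a]; first exact: mem0v.
by rewrite mem_radj dagZ dag1 rpredZ // mem_rid1.
Qed.

Lemma rcomp1r X Y (r : qrel X Y) : rcomp r (rid X) = r.
Proof. by rewrite -[LHS]radjK radj_comp radj1 rcomp1l radjK. Qed.

Lemma rmeet_le X Y (r s t : qrel X Y) :
  rle t r -> rle t s -> rle t (rmeet r s).
Proof. by move=> tr ts x y; rewrite subv_cap tr ts. Qed.

Lemma rmeetl X Y (r s : qrel X Y) : rle (rmeet r s) r.
Proof. by move=> x y; exact: capvSl. Qed.

Lemma rmeetr X Y (r s : qrel X Y) : rle (rmeet r s) s.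
Proof. by move=> x y; exact: capvSr. Qed.

End Components.

Section Products.
Implicit Types X Y Z : qset C.

Lemma mem_rprod X1 X2 Y1 Y2 (r : qrel X1 Y1) (s : qrel X2 Y2) x y f g :
  f \in r x.1 y.1 -> g \in s x.2 y.2 -> tensh f g \in rprod r s x y.
Proof. by move=> rf sg; apply: mem_vspan; exists f, g. Qed.

Lemma rprod_le X1 X2 Y1 Y2 (r : qrel X1 Y1) (s : qrel X2 Y2)
    (t : qrel (qprod X1 X2) (qprod Y1 Y2)) :
  (forall x1 x2 y1 y2 f g, f \in r x1 y1 -> g \in s x2 y2 ->
    tensh f g \in t (x1, x2) (y1, y2)) -> rle (rprod r s) t.
Proof.
move=> rst [x1 x2] [y1 y2]; apply: vspan_min => _ [f [g [/= rf sg ->]]].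
exact: rst.
Qed.

Lemma rprodS X1 X2 Y1 Y2 (r r' : qrel X1 Y1) (s s' : qrel X2 Y2) :
  rle r r' -> rle s s' -> rle (rprod r s) (rprod r' s').
Proof.
move=> rr ss; apply: rprod_le => x1 x2 y1 y2 f g rf sg.
by apply: mem_rprod; [exact: (subvP (rr _ _))|exact: (subvP (ss _ _))].
Qed.

Lemma radj_prod X1 X2 Y1 Y2 (r : qrel X1 Y1) (s : qrel X2 Y2) :
  radj (rprod r s) = rprod (radj r) (radj s).
Proof.
suff le X1' X2' Y1' Y2' (r' : qrel X1' Y1') (s' : qrel X2' Y2') :
    rle (rprod (radj r') (radj s')) (radj (rprod r' s')).
  apply: rle_anti => //; apply/radj_le.
  by rewrite -{1}(radjK s) -{1}(radjK r); exact: le.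
apply: rprod_le => x1 x2 y1 y2 f g; rewrite !mem_radj => rf sg.
have -> := @mem_radj _ _ (rprod r' s') (y1, y2) (x1, x2) (tensh f g).
by have -> := dag_tensh f g; apply: mem_rprod.
Qed.

Lemma rprod_comp X1 X2 Y1 Y2 Z1 Z2 (r : qrel X1 Y1) (s : qrel X2 Y2)
    (r' : qrel Y1 Z1) (s' : qrel Y2 Z2) :
  rprod (rcomp r' r) (rcomp s' s) = rcomp (rprod r' s') (rprod r s).
Proof.
apply: rle_anti.
  apply: rprod_le => x1 x2 z1 z2 f g rf; move: g.
  apply: rcomp_ind => [|a u v Du Dv|y2 g' g sg' sg].
  - by rewrite tensh0r mem0v.
  - by rewrite tenshPr rpredD ?rpredZ.
  move: f rf; apply: rcomp_ind => [|a u v Du Dv|y1 f' f rf' rf].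
  - by rewrite tensh0l mem0v.
  - by rewrite tenshPl rpredD ?rpredZ.
  rewrite tensh_comp.
  have rs : tensh f g \in rprod r s (x1, x2) (y1, y2) by exact: mem_rprod.
  have rs' : tensh f' g' \in rprod r' s' (y1, y2) (z1, z2) by exact: mem_rprod.
  exact: mem_rcomp rs' rs.
apply: rcomp_le => x y z v w + rw; move: v; apply: vspan_ind.
- by rewrite comp_lfun0l mem0v.
- move=> a u u' Du Du'.
  by rewrite comp_lfunDl -comp_lfunZl rpredD ?rpredZ.
move=> _ [f' [g' [rf' sg' ->]]]; move: w rw; apply: vspan_ind.
- by rewrite comp_lfun0r mem0v.
- move=> a v v' Dv Dv'.
  by rewrite comp_lfunDr -comp_lfunZr rpredD ?rpredZ.
move=> _ [f [g [rf sg ->]]]; rewrite -tensh_comp.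
by apply: mem_rprod; [exact: mem_rcomp rf' rf|exact: mem_rcomp sg' sg].
Qed.

Lemma rprod1 X Y : rprod (rid X) (rid Y) = rid (qprod X Y).
Proof.
apply: rle_anti.
  apply: rprod_le => x1 x2 y1 y2 f g + Ig; move: y1 f.
  apply: rid_ind => [y1|a]; first by rewrite tensh0l mem0v.
  move: y2 g Ig; apply: rid_ind => [y2|b]; first by rewrite tensh0r mem0v.
  rewrite tenshZl tenshZr tensh1.
  by rewrite !rpredZ //; exact: (@mem_rid1 (qprod X Y) (x1, x2)).
move=> x y; apply/subvP; move: y; apply: rid_ind => [y|a]; first exact: mem0v.
by rewrite rpredZ // -tensh1; apply: mem_rprod; exact: mem_rid1.
Qed.

End Products.

End Relations.

(** * Projections in *-algebras of operators *)

Section OperatorAlgebras.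
Local Open Scope ring_scope.
Variable C : numClosedFieldType.
Implicit Types H K : hilb C.

(** The matrix of f in the orthonormal basis acts on row vectors, and its
characteristic polynomial has a root. *)
Lemma lfun_eigenvector H (f : 'End(H)) :
  exists a, exists2 x, x != 0 & f x = a *: x.
Proof.
pose A : 'M[C]_(dim H) := \matrix_(i, j) hdot H (f (onb H i)) (onb H j).
have sA : size (char_poly A) != 1%N by rewrite size_char_poly eqSS -lt0n hilb_neq0.
have [a] := closed_rootP _ sA.
rewrite -eigenvalue_root_char => /eigenvalueP[v vA v0].
exists a; exists (\sum_i v 0 i *: onb H i).
  apply: contra v0 => /eqP x0; apply/eqP/rowP => j; rewrite mxE.
  have : hdot H (\sum_i v 0 i *: onb H i) (onb H j) = 0 by rewrite x0 linear0l.
  rewrite hdot_suml => <-.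
  rewrite (bigD1 j) //= linearZl_LR /= onbE eqxx mulr1 big1 ?addr0 // => i ij.
  by rewrite linearZl_LR /= onbE (negPf ij) mulr0.
rewrite linear_sum scaler_sumr.
under eq_bigr => i _ do rewrite linearZ /= (onb_expand (f _)) scaler_sumr.
rewrite exchange_big; apply: eq_bigr => j _ /=.
under eq_bigr => i _ do rewrite scalerA.
rewrite -scaler_suml scalerA; congr (_ *: _).
have /rowP/(_ j) := vA; rewrite !mxE => <-.
by apply: eq_bigr => i _; rewrite mxE.
Qed.

Section StarAlgebra.
Variables (H : hilb C) (A : {vspace 'End(H)}).
Hypotheses (A1 : \1%VF \in A)
  (AM : forall f g, f \in A -> g \in A -> (f \o g)%VF \in A)
  (Adag : forall f, f \in A -> dag f \in A).

(** Left multiplication by a selfadjoint N has the same kernel as its square, so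
it is bijective on the finite-dimensional space N A; thus N A = N^2 A, which
contains N. *)
Lemma selfadjoint_divides_square N : N \in A -> dag N = N ->
  exists2 b, b \in A & (N \o (N \o b))%VF = N.
Proof.
move=> AN NN.
have lin : linear (fun f : 'End(H) => (N \o f)%VF).
  by move=> a f g; rewrite comp_lfunDr -comp_lfunZr.
pose L : {linear 'End(H) -> 'End(H)} :=
  HB.pack (fun f : 'End(H) => (N \o f)%VF) (GRing.isLinear.Build _ _ _ _ _ lin).
pose phi : 'Hom('End(H), 'End(H)) := linfun L.
have phiE f : phi f = (N \o f)%VF by rewrite lfunE.
pose B := (phi @: A)%VS.
have BA : (phi @: B <= B)%VS.
  apply/limgS/subvP => _ /memv_imgP[f Af ->]; rewrite phiE; exact: AM.
have /eqP eB : (phi @: B)%VS == B.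
  rewrite eqEdim BA limg_dim_eq ?leqnn //; apply: subv_anti.
  rewrite sub0v andbT; apply/subvP => f.
  move=> /memv_capP[/memv_imgP[g _ ->]]; rewrite memv_ker memv0 !phiE.
  move=> /eqP NNg; apply/eqP/lfunP => x; rewrite comp_lfunE zero_lfunE.
  apply: dag_comp_eq0; rewrite NN.
  by have /lfunP/(_ x) := NNg; rewrite !comp_lfunE zero_lfunE.
have : phi \1%VF \in B by exact: memv_img.
rewrite -eB => /memv_imgP[_ /memv_imgP[b Ab ->]].
by rewrite !phiE comp_lfun1r; exists b.
Qed.

(** If T in A is not scalar, subtracting an eigenvalue gives a nonzero M in A that
is not injective; N = M^+ M is moreover selfadjoint. Writing N = N^2 b with b in
A, the element p = 1 - N b is the orthogonal projection onto the kernel of N.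
This avoids functional calculus. *)
Lemma nontrivial_projection : ~~ (A <= <[\1%VF]>)%VS ->
  exists2 p, p \in A & [/\ (p \o p)%VF = p, dag p = p, p != 0 & p != \1%VF].
Proof.
move=> /subvPn[T AT nT]; have [a [x x0 Tx]] := lfun_eigenvector T.
pose M := T - a *: \1%VF.
have AM' : M \in A by rewrite rpredB ?rpredZ.
have Mx : M x = 0 by rewrite add_lfunE opp_lfunE scale_lfunE id_lfunE Tx subrr.
pose N := (dag M \o M)%VF.
have AN : N \in A by rewrite AM ?Adag.
have NN : dag N = N by rewrite dag_comp dagK.
have Nx : N x = 0 by rewrite comp_lfunE Mx linear0.
have N0 : N != 0.
  apply: contra nT => /eqP N0.
  suff /eqP : M = 0 by rewrite subr_eq0 => /eqP->; rewrite memvZ ?memv_line.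
  apply/lfunP => y; rewrite zero_lfunE; apply: dag_comp_eq0.
  by rewrite -comp_lfunE -/N N0 zero_lfunE.
have [b Ab Nb] := selfadjoint_divides_square AN NN.
pose p := \1%VF - (N \o b)%VF.
have Np : (N \o p)%VF = 0 by rewrite comp_lfunDr comp_lfunNr Nb comp_lfun1r subrr.
have pN : (dag p \o N)%VF = 0 by rewrite -NN -dag_comp Np dag0.
(* Hence p^+ = p^+ p, whose right-hand side is selfadjoint. *)
have pp : (dag p \o p)%VF = dag p.
  rewrite {2}/p comp_lfunDr comp_lfun1r comp_lfunNr comp_lfunA pN.
  by rewrite comp_lfun0l subr0.
have dp : dag p = p by rewrite -{2}[p]dagK -pp dag_comp dagK pp.
exists p; first by rewrite rpredB // AM.
split=> //; first by rewrite -{1}dp pp.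
  apply: contraNneq x0 => p0; move/eqP: (p0); rewrite subr_eq0 => /eqP Nb1.
  have : dag (N \o b)%VF x = x by rewrite -Nb1 dag1 id_lfunE.
  by rewrite dag_comp NN comp_lfunE Nx linear0 => <-.
by apply: contraNneq N0 => p1; rewrite -[N]comp_lfun1r -p1 Np.
Qed.

End StarAlgebra.

Definition unitary H K (u : 'Hom(H, K)) :=
  (dag u \o u)%VF = \1%VF /\ (u \o dag u)%VF = \1%VF.

Lemma unitary_dag H K (u : 'Hom(H, K)) : unitary u -> unitary (dag u).
Proof. by case=> u1 u2; split; rewrite dagK. Qed.

Lemma unitary_comp H K (L : hilb C) (u : 'Hom(K, L)) (v : 'Hom(H, K)) :
  unitary u -> unitary v -> unitary (u \o v)%VF.
Proof.
move=> [u1 u2] [v1 v2]; split; rewrite dag_comp comp_lfunA.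
  by rewrite -(comp_lfunA _ (dag u)) u1 comp_lfun1r.
by rewrite -(comp_lfunA u) v2 comp_lfun1r.
Qed.

Lemma unitary1 H : unitary (\1%VF : 'End(H)).
Proof. by split; rewrite dag1 comp_lfun1l. Qed.

(** Turns a nontrivial projection into a nonscalar unitary. *)
Lemma unitary_reflection H (p : 'End(H)) : (p \o p)%VF = p -> dag p = p ->
  unitary (\1%VF - 2%:R *: p).
Proof.
move=> pp dp; set q := 2%:R *: p.
have qq : (q \o q)%VF = q + q.
  by rewrite /q -comp_lfunZl -comp_lfunZr pp scalerA -scalerDl -natrM -natrD.
have du : dag (\1%VF - q) = \1%VF - q.
  by rewrite -scaleN1r dagD !dagZ dag1 dp rmorphN /= conjC1 conjC_nat.
suff uu : ((\1 - q) \o (\1 - q))%VF = \1%VF by split; rewrite du.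
rewrite comp_lfunDl comp_lfunNl comp_lfun1l comp_lfunDr comp_lfunNr.
by rewrite comp_lfun1r qq opprD opprK addKr subrK.
Qed.

(** The scalars v^+ v and v v^+ agree, and are positive because v is nonzero;
dividing v by the square root of this number makes it unitary. *)
Lemma schur_unitary H K (v : 'Hom(H, K)) : v != 0 ->
  (dag v \o v)%VF \in <[\1%VF : 'End(H)]>%VS ->
  (v \o dag v)%VF \in <[\1%VF : 'End(K)]>%VS ->
  exists2 c, c != 0 & unitary (c *: v).
Proof.
move=> v0 /vlineP[a va] /vlineP[b vb].
have [x vx] : exists x, v x != 0.
  apply: contrapT => nv; case/eqP: v0; apply/lfunP => x; rewrite zero_lfunE.
  by apply/eqP/negPn/negP => vx; apply: nv; exists x.
have ab : a = b.
  have : ((v \o dag v) \o v)%VF = (v \o (dag v \o v))%VF by rewrite comp_lfunA.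
  rewrite va vb -comp_lfunZl -comp_lfunZr comp_lfun1l comp_lfun1r => /eqP.
  by rewrite -subr_eq0 -scalerBl scaler_eq0 (negPf v0) orbF subr_eq0 => /eqP.
have x0 : x != 0 by apply: contraNneq vx => ->; rewrite linear0.
have a0 : 0 < a^*.
  have : 0 < hdot K (v x) (v x) by rewrite dnorm_gt0.
  rewrite dagP -comp_lfunE va scale_lfunE id_lfunE linearZr_LR /=.
  by rewrite pmulr_lgt0 // dnorm_gt0.
have aR : a^* = a by rewrite -[RHS]conjCK; apply/esym/conj_Creal/gtr0_real.
rewrite aR in a0.
pose c := (sqrtC a)^-1.
have c0 : 0 <= c by rewrite invr_ge0 sqrtC_ge0 ltW.
have cR : c^* = c by apply/conj_Creal/ger0_real.
have cc : c * c * a = 1.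
  by rewrite /c -invfM -expr2 sqrtCK mulVf // gt_eqF.
exists c; first by rewrite invr_eq0 sqrtC_eq0 gt_eqF.
split; rewrite dagZ cR -comp_lfunZl -comp_lfunZr scalerA.
  by rewrite va scalerA cc scale1r.
by rewrite vb -ab scalerA cc scale1r.
Qed.

Section Subspace.
Variables (H : hilb C) (U : {vspace H}).

Definition subdot (u v : subvs_of U) : C := hdot H (vsval u) (vsval v).

Fact subdot_linearl v : linear_for *%R (subdot ^~ v).
Proof. by move=> a u w; rewrite /subdot linearP linearDl linearZl_LR. Qed.

Fact subdot_linearr v : linear_for (Num.conj \; *%R) (subdot v).
Proof. by move=> a u w; rewrite /subdot linearP. Qed.

HB.instance Definition _ := bilinear_isBilinear.Build C _ _ _
  ( *%R) (Num.conj \; *%R) subdot (subdot_linearl, subdot_linearr).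

Fact subdot_herm u v : subdot u v = (-1) ^+ false * (subdot v u)^*.
Proof. by rewrite mul1r; exact: hdotC. Qed.

HB.instance Definition _ := isHermitianSesquilinear.Build C _ false
  Num.conj subdot subdot_herm.

Fact subdot_gt0 u : u != 0 -> 0 < subdot u u.
Proof.
move=> u0; rewrite /subdot dnorm_gt0; apply: contra u0 => /eqP u0.
by apply/eqP/val_inj; rewrite [LHS]u0 linear0.
Qed.

HB.instance Definition _ := isDotProduct.Build C _ subdot subdot_gt0.

End Subspace.

(** K is the image of p with the restricted inner product, and v its inclusion. *)
Lemma split_projection H (p : 'End(H)) :
    (p \o p)%VF = p -> dag p = p -> p != 0 -> p != \1%VF ->
  exists (K : hilb C) (v : 'Hom(K, H)),
    [/\ (dim K < dim H)%N, (dag v \o v)%VF = \1%VF & (v \o dag v)%VF = p].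
Proof.
move=> pp dp p0 p1; pose U := limg p.
have pU x : x \in U -> p x = x.
  by move=> /memv_imgP[y _ ->]; rewrite -comp_lfunE pp.
have dU : (0 < dim (subvs_of U))%N.
  rewrite -[dim _]/(\dim U) lt0n dimv_eq0; apply: contra p0 => /eqP U0.
  apply/eqP/lfunP => x; apply/eqP; rewrite zero_lfunE -memv0 -U0.
  by rewrite memv_img ?memvf.
pose K := Hilb (@subdot H U) dU.
have lin : linear (fun u : K => vsval u : H) by move=> a u w; rewrite linearP.
pose L : {linear K -> H} :=
  HB.pack (fun u : K => vsval u : H) (GRing.isLinear.Build _ _ _ _ _ lin).
pose v : 'Hom(K, H) := linfun L.
have vE (u : K) : v u = vsval u by rewrite lfunE.
have vdv x : v (dag v x) = p x.
  have pxU : p x \in U by rewrite memv_img ?memvf.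
  suff -> : dag v x = vsproj U (p x) :> K by rewrite vE vsprojK.
  apply: hdot_inj => u; rewrite -dagP /= /subdot vsprojK // vE.
  by rewrite -dp -dagP pU ?subvsP.
exists K, v; split.
- rewrite -[dim K]/(\dim U) -dimvf ltn_neqAle dimvS ?subvf // andbT.
  apply: contra p1 => /eqP eU.
  have /eqP UH : U == fullv by rewrite eqEdim subvf eU /=.
  by apply/eqP/lfunP => x; rewrite id_lfunE pU // UH memvf.
- apply/lfunP => u; rewrite comp_lfunE id_lfunE; apply/val_inj.
  by have := vdv (v u); rewrite vE [v u]vE => /= ->; rewrite pU ?subvsP.
- by apply/lfunP => x; rewrite comp_lfunE vdv.
Qed.

Fact euclid_neq0 n : (0 < dim 'M[C]_(1, n.+1))%N.
Proof. by []. Qed.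

(** Standard Hilbert spaces, of dimension n + 1 as hilb excludes the zero space.
Realizing representations on them lets the atoms of the exponential be
isomorphism classes of irreducible representations rather than arbitrary
ones on arbitrary spaces. *)
Definition euclid n : hilb C := Hilb (@mxdot C 1 n.+1) (euclid_neq0 n).

Lemma unitary_euclid H : exists n (u : 'Hom(euclid n, H)), unitary u.
Proof.
have := hilb_neq0 H; move: (onb H) (@onbE _ H) (@onb_expand _ H).
case: (dim H) => // n e eE eH _; exists n.
have lin : linear (fun M : euclid n => \sum_i (M : 'M_(_, _)) 0 i *: e i).
  move=> a M N; rewrite scaler_sumr -big_split; apply: eq_bigr => i _ /=.
  by rewrite !mxE scalerDl scalerA.
pose L : {linear euclid n -> H} :=
  HB.pack (fun M : euclid n => \sum_i (M : 'M_(_, _)) 0 i *: e i)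
    (GRing.isLinear.Build _ _ _ _ _ lin).
pose u : 'Hom(euclid n, H) := linfun L.
have uE M : u M = \sum_i (M : 'M_(_, _)) 0 i *: e i by rewrite lfunE.
have uK M i : hdot H (u M) (e i) = (M : 'M_(_, _)) 0 i.
  rewrite uE hdot_suml (bigD1 i) //= linearZl_LR /= eE eqxx mulr1.
  rewrite big1 ?addr0 // => j ji.
  by rewrite linearZl_LR /= eE (negPf ji) mulr0.
have duE x : dag u x = \row_i hdot H x (e i) :> euclid n.
  apply: hdot_inj => M; rewrite -dagP uE hdot_suml /= /mxdot big_ord1.
  by apply: eq_bigr => i _; rewrite linearZl_LR /= mxE -hdotC.
exists u; split; apply/lfunP => x; rewrite comp_lfunE id_lfunE.
  by rewrite duE; apply/rowP => i; rewrite mxE uK.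
rewrite uE [RHS]eH; apply: eq_bigr => i _.
by rewrite duE mxE.
Qed.

End OperatorAlgebras.

(** * Functions and residuals *)

Section Functions.
Local Open Scope ring_scope.
Variable C : numClosedFieldType.
Implicit Types X Y Z : qset C.

(** A function f is left adjoint to f^+; the two lemmas below move it across an
inequality, on either side. *)
Section Adjunctions.
Variables (X Y : qset C) (f : qrel X Y).
Hypothesis qf : qfun f.

Lemma qfun_shiftl W (r : qrel W X) (s : qrel W Y) :
  rle (rcomp f r) s <-> rle r (rcomp (radj f) s).
Proof.
case: qf => tot sv; split=> le.
  apply: rle_trans (rcompSr (radj f) le).
  by rewrite rcompA -{1}[r]rcomp1l; exact: rcompSl.
apply: rle_trans (rcompSr f le) _.
by rewrite rcompA -{2}[s]rcomp1l; exact: rcompSl.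
Qed.

Lemma qfun_shiftr W (r : qrel X W) (s : qrel Y W) :
  rle (rcomp r (radj f)) s <-> rle r (rcomp s f).
Proof.
case: qf => tot sv; split=> le.
  apply: rle_trans (rcompSl f le).
  by rewrite -rcompA -{1}[r]rcomp1r; exact: rcompSr.
apply: rle_trans (rcompSl _ le) _.
by rewrite -rcompA -{2}[s]rcomp1r; exact: rcompSr.
Qed.

End Adjunctions.

Lemma qfun_id X : qfun (rid X).
Proof. by split; rewrite radj1 rcomp1l; exact: rle_refl. Qed.

Lemma qfun_comp X Y Z (f : qrel X Y) (g : qrel Y Z) :
  qfun f -> qfun g -> qfun (rcomp g f).
Proof.
move=> qf qg; split; rewrite radj_comp.
  apply: (rle_trans qf.1); rewrite -rcompA; apply: rcompSr.
  exact/(qfun_shiftl qg)/rle_refl.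
apply: rle_trans qg.2; rewrite rcompA; apply: rcompSl.
exact/(qfun_shiftr qf)/rle_refl.
Qed.

Lemma qfun_prod X Y X' Y' (f : qrel X Y) (g : qrel X' Y') :
  qfun f -> qfun g -> qfun (rprod f g).
Proof.
move=> [f1 f2] [g1 g2]; split; rewrite radj_prod -rprod_comp -rprod1;
  exact: rprodS.
Qed.

(** g <= g f^+ f <= g g^+ f <= f. *)
Lemma qfun_le_eq X Y (f g : qrel X Y) : qfun f -> qfun g -> rle f g -> f = g.
Proof.
move=> qf qg fg; apply: rle_anti => //.
rewrite -[f]rcomp1l; apply/(qfun_shiftr qf).
by apply: rle_trans qg.2; exact/rcompSr/radjS.
Qed.

Lemma pullback_comp X Y (f : qrel X Y) (r s : qrel Y Y) : qfun f ->
  rle (rcomp (rcomp (radj f) (rcomp r f)) (rcomp (radj f) (rcomp s f)))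
      (rcomp (radj f) (rcomp (rcomp r s) f)).
Proof.
move=> qf; rewrite -!rcompA; do 2!apply: rcompSr.
exact/(qfun_shiftl qf)/rle_refl.
Qed.

(** Pulling back along a function has a left adjoint, so it preserves meets. *)
Lemma pullback_meet X Y (f : qrel X Y) (r s : qrel Y Y) : qfun f ->
  rle (rmeet (rcomp (radj f) (rcomp r f)) (rcomp (radj f) (rcomp s f)))
      (rcomp (radj f) (rcomp (rmeet r s) f)).
Proof.
move=> qf; apply/(qfun_shiftl qf)/(qfun_shiftr qf)/rmeet_le;
  apply/(qfun_shiftr qf)/(qfun_shiftl qf); [exact: rmeetl|exact: rmeetr].
Qed.

(** The two conditions on a function do not mix different atoms of its domain, so
being a function can be tested on one atom at a time. *)
Lemma qfun_atomwise X Y (f : qrel X Y) :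
  qfun f <-> forall x, \1%VF \in rcomp (radj f) f x x /\
    forall y y' v w, v \in f x y -> w \in f x y' ->
      (v \o dag w)%VF \in rid Y y' y.
Proof.
split=> [[tot sv] x|qf].
  split=> [|y y' v w fv fw]; first exact/(subvP (tot x x))/mem_rid1.
  apply: (subvP (sv y' y)); apply: mem_rcomp fv _.
  by rewrite mem_radj dagK.
split=> [x x'|].
  apply/subvP; move: x'; apply: rid_ind => [x'|a]; first exact: mem0v.
  by rewrite rpredZ //; have [] := qf x.
apply: rcomp_le => y' x y v w fv; rewrite mem_radj => fw.
by have [_] := qf x; move=> /(_ _ _ _ _ fv fw); rewrite dagK.
Qed.

Section TensorResidual.
Variables X X' Y Y' : qset C.

(** The tensor residual, that is, the largest G with G x S <= U. Its component at
(x, x') depends on U only through the components at x and x', which allows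
intertwiners to be studied one atom at a time. *)
Definition tres (S : qrel Y Y') (U : qrel (qprod X Y) (qprod X' Y')) :
    qrel X X' :=
  fun x x' => vspan [set g : 'Hom(X x, X' x') | forall y y' s, s \in S y y' ->
    tensh g s \in U (x, y) (x', y')].

Lemma mem_tres S U x x' g : g \in tres S U x x' <->
  forall y y' s, s \in S y y' -> tensh g s \in U (x, y) (x', y').
Proof.
apply: (@vspan_id _ _ [set g : 'Hom(X x, X' x') | forall y y' s, s \in S y y' ->
    tensh g s \in U (x, y) (x', y')]) => [|a u v Du Dv] y y' s Ss.
  by rewrite tensh0l mem0v.
by rewrite tenshPl rpredD ?rpredZ //; [exact: Du|exact: Dv].
Qed.

Lemma tresP S U G : rle G (tres S U) <-> rle (rprod G S) U.
Proof.
split=> [GSU|GSU x x'].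
  apply: rprod_le => x y x' y' g s Gg; move: y y' s; apply/mem_tres.
  exact: (subvP (GSU _ _)).
apply/subvP => g Gg; apply/mem_tres => y y' s Ss.
by apply: (subvP (GSU _ _)); exact: mem_rprod.
Qed.

End TensorResidual.

Section Intertwiners.
Variables Y Z : qset C.

(** The intertwiners from F to F', that is, the largest G with F' (G x I) <= F when
F' is a function. In the form below its involution symmetry is visible. *)
Definition qhom X X' (F : qrel (qprod X Y) Z) (F' : qrel (qprod X' Y) Z) :
    qrel X X' :=
  tres (rid Y) (rcomp (radj F') F).

Lemma qhom_le X X' (F : qrel (qprod X Y) Z) (F' : qrel (qprod X' Y) Z) G :
  qfun F' -> rle G (qhom F F') <-> rle (rcomp F' (rprod G (rid Y))) F.
Proof. by move=> qF'; rewrite tresP (qfun_shiftl qF'). Qed.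

Lemma qhomS X X' (F : qrel (qprod X Y) Z) (F' : qrel (qprod X' Y) Z) :
  qfun F' -> rle (rcomp F' (rprod (qhom F F') (rid Y))) F.
Proof. by move=> qF'; apply/(qhom_le _ _ qF')/rle_refl. Qed.

Lemma radj_qhom X X' (F : qrel (qprod X Y) Z) (F' : qrel (qprod X' Y) Z) :
  radj (qhom F F') = qhom F' F.
Proof.
suff le X1 X2 (F1 : qrel (qprod X1 Y) Z) (F2 : qrel (qprod X2 Y) Z) :
    rle (radj (qhom F1 F2)) (qhom F2 F1).
  apply: rle_anti => //; exact/radj_le.
apply/tresP; rewrite -[rid Y]radj1 -radj_prod radj_le radj_comp radjK.
exact/tresP/rle_refl.
Qed.

Lemma qhom_comp X1 X2 X3 (F1 : qrel (qprod X1 Y) Z) (F2 : qrel (qprod X2 Y) Z)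
    (F3 : qrel (qprod X3 Y) Z) : qfun F2 -> qfun F3 ->
  rle (rcomp (qhom F2 F3) (qhom F1 F2)) (qhom F1 F3).
Proof.
move=> q2 q3; apply/(qhom_le _ _ q3).
rewrite -[rid Y]rcomp1l rprod_comp rcompA.
apply: rle_trans (qhomS F1 q2); apply: rcompSl.
exact: qhomS.
Qed.

Lemma qhom_id X (F : qrel (qprod X Y) Z) : qfun F -> rle (rid X) (qhom F F).
Proof.
by move=> qF; apply/(qhom_le _ _ qF); rewrite rprod1 rcomp1r; exact: rle_refl.
Qed.

Lemma mem_qhom_comp X1 X2 X3 (F1 : qrel (qprod X1 Y) Z)
    (F2 : qrel (qprod X2 Y) Z) (F3 : qrel (qprod X3 Y) Z) x1 x2 x3 v w :
  qfun F2 -> qfun F3 -> w \in qhom F2 F3 x2 x3 -> v \in qhom F1 F2 x1 x2 ->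
  (w \o v)%VF \in qhom F1 F3 x1 x3.
Proof.
move=> q2 q3 Fw Fv; apply: (subvP (qhom_comp F1 q2 q3 _ _)).
exact: mem_rcomp Fw Fv.
Qed.

Lemma mem_qhom_dag X1 X2 (F1 : qrel (qprod X1 Y) Z)
    (F2 : qrel (qprod X2 Y) Z) x1 x2 v :
  v \in qhom F1 F2 x1 x2 -> dag v \in qhom F2 F1 x2 x1.
Proof. by rewrite -(radj_qhom F1 F2) mem_radj dagK. Qed.

(** A component of qhom F F on one atom is a *-algebra. If it had a nontrivial
projection p, then 1 - 2p would be a unitary intertwiner that is not scalar,
against the hypothesis. So all these algebras are scalar, and then any nonzero
intertwiner between two atoms is a multiple of a unitary one. *)
Lemma qhom_le_rid X (F : qrel (qprod X Y) Z) : qfun F ->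
  (forall x x' u, u \in qhom F F x x' -> unitary u -> u \in rid X x x') ->
  rle (qhom F F) (rid X).
Proof.
move=> qF uF.
have homM x1 x2 x3 v w : w \in qhom F F x2 x3 -> v \in qhom F F x1 x2 ->
  (w \o v)%VF \in qhom F F x1 x3 by exact: mem_qhom_comp.
have hom1 x : \1%VF \in qhom F F x x by exact/(subvP (qhom_id qF x x))/mem_rid1.
have scal x : (qhom F F x x <= <[\1%VF]>)%VS.
  apply/negPn/negP => /nontrivial_projection[//| |v|p Fp [pp dp p0 p1]].
  - by move=> v w; exact: homM.
  - exact: mem_qhom_dag.
  have : \1%VF - 2%:R *: p \in rid X x x.
    apply: uF; last exact: unitary_reflection.
    by rewrite rpredB ?rpredZ ?hom1.
  rewrite rid_refl => /vlineP[c /eqP]; rewrite subr_eq addrC -subr_eq => /eqP pc.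
  have [d pd] : exists d, p = d *: \1%VF.
    exists (2%:R^-1 * (1 - c)); rewrite -scalerA scalerBl scale1r pc.
    by rewrite scalerA mulVf ?scale1r // pnatr_eq0.
  move/eqP: pp; rewrite {1}pd -comp_lfunZl comp_lfun1l -subr_eq0.
  rewrite -{2}[p]scale1r -scalerBl scaler_eq0 (negPf p0) orbF subr_eq0 => /eqP d1.
  by rewrite pd d1 scale1r eqxx in p1.
move=> x x'; apply/subvP => v Fv; have [->|v0] := eqVneq v 0; first exact: mem0v.
have [||c c0 u] := schur_unitary v0.
- by apply: (subvP (scal x)); apply: (homM _ x' _ _ _ _ Fv); exact: mem_qhom_dag.
- by apply: (subvP (scal x')); apply: (homM _ _ _ _ _ Fv); exact: mem_qhom_dag.
rewrite -[v]scale1r -(mulVf c0) -scalerA rpredZ //; apply: uF u.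
by rewrite rpredZ.
Qed.

End Intertwiners.

End Functions.

(** * The exponential of quantum sets *)

Section Exponential.
Local Open Scope ring_scope.
Variable C : numClosedFieldType.
Implicit Types H K L : hilb C.

Definition single (H : hilb C) : qset C := QSet (fun _ : unit => H).

Definition single_rel H K (v : 'Hom(H, K)) : qrel (single H) (single K) :=
  fun _ _ => <[v]>%VS.

Lemma single_rel_le H K (v : 'Hom(H, K)) (G : qrel (single H) (single K)) :
  rle (single_rel v) G <-> v \in G tt tt.
Proof.
split=> [/(_ tt tt)|Gv [] []]; first by rewrite -memvE.
by rewrite -memvE.
Qed.

Lemma single_rel_comp H K L (w : 'Hom(K, L)) (v : 'Hom(H, K)) :
  rcomp (single_rel w) (single_rel v) = single_rel (w \o v)%VF.
Proof.
apply: rle_anti; last first.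
  have ww : w \in single_rel w tt tt by exact: memv_line.
  have vv : v \in single_rel v tt tt by exact: memv_line.
  by apply/single_rel_le; exact: mem_rcomp ww vv.
apply: rcomp_le => -[] [] [] _ _ /vlineP[a ->] /vlineP[b ->].
by rewrite -comp_lfunZl -comp_lfunZr !memvZ ?memv_line.
Qed.

Lemma radj_single_rel H K (v : 'Hom(H, K)) :
  radj (single_rel v) = single_rel (dag v).
Proof.
apply: rle_anti => -[] []; apply/subvP => w; rewrite mem_radj.
  by move=> /vlineP[a aw]; rewrite -[w]dagK aw dagZ memvZ // memv_line.
by move=> /vlineP[a ->]; rewrite dagZ dagK memvZ // memv_line.
Qed.

Lemma single_rel1 H : single_rel (\1%VF : 'End(H)) = rid (single H).
Proof. by apply: rle_anti => -[] []; rewrite rid_refl. Qed.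

Lemma qfun_single_rel H K (u : 'Hom(H, K)) : unitary u -> qfun (single_rel u).
Proof.
move=> [u1 u2]; split; rewrite radj_single_rel single_rel_comp ?u1 ?u2
  single_rel1; exact: rle_refl.
Qed.

Section Representations.
Variables Y Z : qset C.

Definition at_atom X (F : qrel (qprod X Y) Z) x :
    qrel (qprod (single (X x)) Y) Z :=
  fun a z => F (x, a.2) z.
Arguments at_atom {X} F x.

Lemma qfun_at_atom X (F : qrel (qprod X Y) Z) x : qfun F -> qfun (at_atom F x).
Proof.
by move=> /qfun_atomwise qF; apply/qfun_atomwise => -[[] y]; exact: (qF (x, y)).
Qed.

(** An intertwining projection v v^+ cuts out a subrepresentation: f (v x I) is
total because v is isometric, and single-valued because f (v v^+ x I) <= f. *)
Lemma restrict_rep H K (f : qrel (qprod (single H) Y) Z) (v : 'Hom(K, H)) :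
    qfun f -> (dag v \o v)%VF = \1%VF -> (v \o dag v)%VF \in qhom f f tt tt ->
  exists2 f' : qrel (qprod (single K) Y) Z, qfun f' & v \in qhom f' f tt tt.
Proof.
move=> qf vv fv; pose f' := rcomp f (rprod (single_rel v) (rid Y)).
exists f'; last exact/single_rel_le/(qhom_le _ _ qf)/rle_refl.
split; rewrite /f' radj_comp radj_prod radj1.
  rewrite -rcompA; apply: rle_trans (rcompSr _ _); last first.
    apply/(qfun_shiftl qf)/rle_refl.
  rewrite -rprod_comp rcomp1l -rprod1; apply: rprodS; last exact: rle_refl.
  by rewrite radj_single_rel single_rel_comp vv single_rel1; exact: rle_refl.
apply: rle_trans qf.2; rewrite rcompA; apply: rcompSl.
rewrite -rcompA -rprod_comp rcomp1l; apply/(qhom_le _ _ qf).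
by rewrite radj_single_rel single_rel_comp; exact/single_rel_le.
Qed.

Record irrep := Irrep {
  irrep_dim : nat;
  irrep_rel :> qrel (qprod (single (euclid C irrep_dim)) Y) Z;
  irrep_fun : qfun irrep_rel;
  irrep_scalar : rle (qhom irrep_rel irrep_rel) (rid _)
}.
Arguments irrep_rel : clear implicits.
Arguments irrep_scalar : clear implicits.

Definition iequiv (r s : irrep) :=
  exists2 u, u \in qhom r s tt tt & unitary u.

Lemma iequiv_refl r : iequiv r r.
Proof.
exists \1%VF; last exact: unitary1.
exact: (subvP (qhom_id (irrep_fun r) tt tt) _ (@mem_rid1 _ (single _) tt)).
Qed.

Lemma iequiv_sym r s : iequiv r s -> iequiv s r.
Proof.
by move=> [u rsu uu]; exists (dag u); [exact: mem_qhom_dag|exact: unitary_dag].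
Qed.

Lemma iequiv_trans r s t : iequiv r s -> iequiv s t -> iequiv r t.
Proof.
move=> [u rsu uu] [v stv uv]; exists (v \o u)%VF; last exact: unitary_comp.
by apply: mem_qhom_comp stv rsu; exact: irrep_fun.
Qed.

(** Choosing a representative in each class. The chosen point depends only on the
predicate iequiv r, which is the same for equivalent r. *)
Lemma canonical_irrep : exists c : irrep -> irrep,
  (forall r, iequiv r (c r)) /\ (forall r s, iequiv r s -> c r = c s).
Proof.
have ex r : exists s, iequiv r s by exists r; exact: iequiv_refl.
exists (fun r => projT1 (cid (ex r))); split=> [r|r s rs]; first by case: cid.
have e : iequiv r = iequiv s.
  apply/funext => t; apply/propext; split; last exact: iequiv_trans.
  exact/iequiv_trans/iequiv_sym.
by move: (ex r) (ex s); rewrite e => e1 e2; rewrite (Prop_irrelevance e1 e2).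
Qed.

Section Construction.
Variable c : irrep -> irrep.
Hypotheses (c_equiv : forall r, iequiv r (c r))
  (c_canon : forall r s, iequiv r s -> c r = c s).

(** One atom for each equivalence class: the fixed points of c are the chosen
representatives. *)
Definition expo : qset C :=
  QSet (fun r : {r : irrep | c r = r} => euclid C (irrep_dim (sval r))).

Definition eval : qrel (qprod expo Y) Z :=
  fun a z => irrep_rel (sval a.1) (tt, a.2) z.

Lemma qfun_eval : qfun eval.
Proof.
apply/qfun_atomwise => -[r y].
by have /qfun_atomwise/(_ (tt, y)) := irrep_fun (sval r).
Qed.

(** Schur: a unitary intertwiner between two atoms makes them equivalent, hence
equal, and then irreducibility makes it scalar. *)
Lemma qhom_eval : rle (qhom eval eval) (rid expo).
Proof.
apply: qhom_le_rid qfun_eval _ => r s u rsu uu.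
have rs : r = s.
  apply: eq_sig_hprop => [t|]; first exact: Prop_irrelevance.
  rewrite -[LHS](svalP r) -[RHS](svalP s).
  by apply: c_canon; exists u.
move: u rsu uu; rewrite -rs => u ru _; rewrite rid_refl.
have := subvP (irrep_scalar (sval r) tt tt) u ru.
by rewrite (@rid_refl _ (single _)).
Qed.

(** The representation is moved to a standard space by u and then to the chosen
representative by w; t is the resulting unitary, and 1 = t^+ t. *)
Lemma irreducible_reduction H (f : qrel (qprod (single H) Y) Z) :
  qfun f -> rle (qhom f f) (rid (single H)) ->
  \1%VF \in rcomp (qhom eval f) (qhom f eval) tt tt.
Proof.
move=> qf irrf; have [n [u uu]] := unitary_euclid H.
have [f' qf' f'u] : exists2 f' : qrel (qprod (single (euclid C n)) Y) Z,
    qfun f' & u \in qhom f' f tt tt.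
  apply: restrict_rep => //; first by case: uu.
  rewrite uu.2; exact: (subvP (qhom_id qf tt tt) _ (@mem_rid1 _ (single H) tt)).
have irrf' : rle (qhom f' f') (rid _).
  move=> [] []; rewrite rid_refl; apply/subvP => v f'v.
  have : (u \o (v \o dag u))%VF \in qhom f f tt tt.
    apply: (mem_qhom_comp qf' qf f'u); apply: (mem_qhom_comp qf' qf' f'v).
    exact: mem_qhom_dag.
  move/(subvP (irrf _ _)); rewrite (@rid_refl _ (single H)) => /vlineP[a uv].
  have -> : v = (dag u \o (u \o (v \o dag u)) \o u)%VF.
    rewrite !comp_lfunA uu.1 comp_lfun1l -comp_lfunA uu.1 comp_lfun1r //.
  by rewrite uv -comp_lfunZr comp_lfun1r -comp_lfunZl uu.1 memvZ ?memv_line.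
pose r := Irrep qf' irrf'; have [w rw uw] := c_equiv r.
have ccr : c (c r) = c r by apply/esym/c_canon.
pose e : atom expo := exist _ (c r) ccr.
pose t := (w \o dag u)%VF.
have ft : t \in qhom f eval tt e.
  apply: (mem_qhom_comp qf' (irrep_fun (c r)) rw); exact: mem_qhom_dag.
have [<- _] : unitary t by apply: unitary_comp => //; exact: unitary_dag.
exact: mem_rcomp (mem_qhom_dag ft) ft.
Qed.

(** Induction on the dimension of H. If f is reducible, 1 = p + (1 - p) for a
nontrivial intertwining projection p, and each summand is v v^+ for an isometric
inclusion v of a smaller representation, to which the induction applies. *)
Lemma complete_reducibility H (f : qrel (qprod (single H) Y) Z) : qfun f ->
  \1%VF \in rcomp (qhom eval f) (qhom f eval) tt tt.
Proof.
have [m] := ubnP (dim H); elim: m H f => // m IHm H f ltH qf.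
have [irrf|red] := pselect (rle (qhom f f) (rid (single H))).
  exact: irreducible_reduction.
have f1 : \1%VF \in qhom f f tt tt.
  exact: (subvP (qhom_id qf tt tt) _ (@mem_rid1 _ (single H) tt)).
have proj p : p \in qhom f f tt tt -> (p \o p)%VF = p -> dag p = p -> p != 0 ->
    p != \1%VF -> p \in rcomp (qhom eval f) (qhom f eval) tt tt.
  move=> fp pp dp p0 p1; have [K [v [ltK vv vp]]] := split_projection pp dp p0 p1.
  rewrite -vp in fp; have [f' qf' f'v] := restrict_rep qf vv fp.
  have /IHm/(_ qf') K1 := leq_trans ltK ltH.
  have : (v \o (\1 \o dag v))%VF \in
      rcomp (qhom f' f)
        (rcomp (rcomp (qhom eval f') (qhom f' eval)) (qhom f f')) tt tt.
    exact: mem_rcomp f'v (mem_rcomp K1 (mem_qhom_dag f'v)).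
  rewrite comp_lfun1l vp; apply/subvP.
  suff le : rle (rcomp (qhom f' f)
        (rcomp (rcomp (qhom eval f') (qhom f' eval)) (qhom f f')))
      (rcomp (qhom eval f) (qhom f eval)) by exact: le.
  rewrite -rcompA rcompA; apply: rcompS; apply: qhom_comp => //.
  exact: qfun_eval.
have /nontrivial_projection[//| |v|p fp [pp dp p0 p1]] :
    ~~ (qhom f f tt tt <= <[\1%VF]>)%VS.
- by apply/negP => sc; apply: red => -[] []; rewrite rid_refl.
- by move=> v w; exact: mem_qhom_comp.
- exact: mem_qhom_dag.
rewrite -(subrK p \1%VF) rpredD ?proj //.
- by rewrite rpredB.
- rewrite comp_lfunDl comp_lfunNl comp_lfun1l comp_lfunDr comp_lfunNr.
  by rewrite comp_lfun1r pp subrr subr0.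
- by rewrite -scaleN1r dagD dagZ dag1 dp rmorphN /= conjC1.
- by rewrite subr_eq0 eq_sym.
- by rewrite -subr_eq0 addrAC subrr add0r oppr_eq0.
Qed.

Lemma eval_exponential : is_exponential eval.
Proof.
split=> [|X F qF]; first exact: qfun_eval.
have qG : qfun (qhom F eval).
  split; rewrite radj_qhom; last first.
    by apply: rle_trans qhom_eval; exact: qhom_comp qfun_eval.
  move=> x x'; apply/subvP; move: x'; apply: rid_ind => [x'|a]; first exact: mem0v.
  (* The component at x of the intertwiners of F is, by unfolding, that of the
     restriction of F to x. *)
  rewrite rpredZ //; exact: (complete_reducibility (qfun_at_atom x qF)).
have qprodI (G : qrel X expo) : qfun G -> qfun (rcomp eval (rprod G (rid Y))).
  by move=> qG'; apply: qfun_comp qfun_eval; exact: qfun_prod (qfun_id _).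
exists (qhom F eval); split=> [|G [qG' FE]].
  split=> //; apply/esym/qfun_le_eq => //; first exact: qprodI.
  exact/qhomS/qfun_eval.
apply/esym/qfun_le_eq => //; apply/(qhom_le _ _ qfun_eval).
by rewrite -FE; exact: rle_refl.
Qed.

End Construction.

Lemma exponential_exists :
  exists (E : qset C) (ev : qrel (qprod E Y) Z), is_exponential ev.
Proof.
have [c [c_equiv c_canon]] := canonical_irrep.
by exists (expo c), (@eval c); exact: eval_exponential.
Qed.

End Representations.
End Exponential.

(** * Inclusions of subsets *)

Section Subsets.
Local Open Scope ring_scope.
Variable C : numClosedFieldType.
Variables (V : qset C) (W : set (atom V)).

Lemma mem_qincl1 (w : atom (qsub W)) : \1%VF \in qincl W w (sval w).
Proof. exact: (@mem_rid1 C V (sval w)). Qed.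

Lemma qincl_isometry : rcomp (radj (qincl W)) (qincl W) = rid (qsub W).
Proof.
apply: rle_anti; last first.
  move=> w w'; apply/subvP; move: w'; apply: rid_ind => [w'|a]; first exact: mem0v.
  have w1 : \1%VF \in radj (qincl W) (sval w) w.
    by rewrite mem_radj dag1; exact: mem_qincl1.
  have := @mem_rcomp _ _ _ _ (radj (qincl W)) (qincl W) w (sval w) w _ _
    w1 (mem_qincl1 w).
  by rewrite comp_lfun1l; exact: rpredZ.
apply: rcomp_le => w a w' v u; rewrite mem_radj /qincl => wv wu.
have [ww'|nww'] := pselect (w = w').
  move: v wv; rewrite -ww' {w' ww'} => v wv; rewrite (@rid_refl _ (qsub W)).
  move: a u wu v wv; apply: rid_ind => [a v _|a v].
    by rewrite comp_lfun0r mem0v.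
  rewrite rid_refl => /vlineP[b vb]; rewrite -[v]dagK vb dagZ dag1.
  by rewrite -comp_lfunZr -comp_lfunZl comp_lfun1r !memvZ ?memv_line.
have [wa|/rid_neq wa] := pselect (sval w = a); last first.
  by move: wu; rewrite wa memv0 => /eqP->; rewrite comp_lfun0r mem0v.
move: wv; rewrite rid_neq ?memv0.
  by move=> /eqP v0; rewrite -[v]dagK v0 dag0 comp_lfun0l mem0v.
rewrite -wa => e; apply: nww'; apply: eq_sig_hprop (esym e) => t.
exact: Prop_irrelevance.
Qed.

(** J J^+ is the partial identity on W. *)
Lemma qincl_range (r : qrel V V) : rle (rcomp (qincl W) (radj (qincl W))) r <->
  forall w, W w -> \1%VF \in r w w.
Proof.
split=> [le w Ww|r1].
  apply: (subvP (le w w)); pose w' : atom (qsub W) := exist _ w Ww.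
  have w1 : \1%VF \in radj (qincl W) w w'.
    by rewrite mem_radj dag1; exact: (mem_qincl1 w').
  have := @mem_rcomp _ _ _ _ (qincl W) (radj (qincl W)) w w' w _ _
    (mem_qincl1 w') w1.
  by rewrite comp_lfun1l.
apply: rcomp_le => a w a' v u; rewrite /qincl => wv; rewrite mem_radj => wu.
move: a' v wv; apply: rid_ind => [a'|b]; first by rewrite comp_lfun0l mem0v.
rewrite -comp_lfunZl comp_lfun1l rpredZ //.
suff rdag u' : u' \in rid V (sval w) a -> dag u' \in r a (sval w).
  by have := rdag _ wu; rewrite dagK.
move: a u' {u wu}; apply: rid_ind => [a|d]; first by rewrite dag0 mem0v.
by rewrite dagZ dag1 rpredZ // r1 //; exact: svalP.
Qed.

Lemma qfun_qincl : qfun (qincl W).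
Proof.
split; first by rewrite qincl_isometry; exact: rle_refl.
by apply/qincl_range => w _; exact: mem_rid1.
Qed.

Lemma qfun_corestrict X (G : qrel X (qsub W)) :
  qfun (rcomp (qincl W) G) -> qfun G.
Proof.
move=> [tot sv]; split.
  apply: rle_trans tot _; rewrite radj_comp -rcompA (rcompA _ (qincl W)).
  by rewrite qincl_isometry rcomp1l; exact: rle_refl.
have -> : rcomp G (radj G) = rcomp (rcomp (radj (qincl W))
    (rcomp (rcomp (qincl W) G) (radj (rcomp (qincl W) G)))) (qincl W).
  rewrite radj_comp !rcompA qincl_isometry rcomp1l -!rcompA.
  by rewrite qincl_isometry rcomp1r.
rewrite -qincl_isometry; apply: rcompSl.
by rewrite -[X in rle _ X]rcomp1r; exact: rcompSr.
Qed.

End Subsets.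

(** * Consequences of the universal property *)

Section UniversalEvaluation.
Local Open Scope ring_scope.
Variable C : numClosedFieldType.
Variables (Y Z E : qset C) (ev : qrel (qprod E Y) Z).
Hypothesis exp_ev : is_exponential ev.

Let qev : qfun ev := exp_ev.1.

Lemma exponential_uniq X (G G' : qrel X E) : qfun G -> qfun G' ->
  rcomp ev (rprod G (rid Y)) = rcomp ev (rprod G' (rid Y)) -> G = G'.
Proof.
move=> qG qG' GG'.
have [|G0 [_ G0u]] := exp_ev.2 X (rcomp ev (rprod G (rid Y))).
  by apply: qfun_comp qev; exact: qfun_prod (qfun_id _).
by rewrite -(G0u G) // (G0u G').
Qed.

(** A unitary intertwiner u from e to e' gives two functions from the quantum set
with single atom E e to E: the inclusion of e, and u followed by the inclusion of e'.
They have the same composite with evaluation, so they are equal, and u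
lies in the identity relation. *)
Lemma qhom_exponential : rle (qhom ev ev) (rid E).
Proof.
apply: qhom_le_rid qev _ => e e' u eu uu.
pose incl a : qrel (single (E a)) E := fun _ => rid E a.
have incl1 a : \1%VF \in incl a tt a by exact: (@mem_rid1 C E a).
have qincl_ a : qfun (incl a).
  have /qfun_atomwise/(_ a) := qfun_id E.
  by move=> qa; apply/qfun_atomwise => -[].
rewrite -[rid E e e']/(incl e tt e').
have <- : rcomp (incl e') (single_rel u) = incl e.
  have qG := qfun_comp (qfun_single_rel uu) (qincl_ e').
  apply: exponential_uniq => //.
  apply: qfun_le_eq; [exact: qfun_comp (qfun_prod _ (qfun_id _)) qev..|].
  apply: rle_trans (rcompSl (rprod (incl e) (rid Y)) (qhomS ev qev)).
  rewrite -rcompA -rprod_comp rcomp1l; apply/rcompSr/rprodS; last exact: rle_refl.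
  suff key a v : v \in rid E e' a ->
      (v \o u)%VF \in rcomp (qhom ev ev) (incl e) tt a.
    apply: rcomp_le => -[] [] a v _ e'v /vlineP[c ->].
    by rewrite -comp_lfunZr rpredZ //; exact: key.
  move: a v; apply: rid_ind => [a|d]; first by rewrite comp_lfun0l mem0v.
  rewrite -comp_lfunZl comp_lfun1l rpredZ // -[u]comp_lfun1r.
  exact: mem_rcomp eu (incl1 e).
have u1 : u \in single_rel u tt tt by exact: memv_line.
have := @mem_rcomp _ (single (E e)) _ E (incl e') (single_rel u) tt tt e' _ _
  (incl1 e') u1.
by rewrite comp_lfun1l.
Qed.


(** * The exponential of quantum posets *)

Section PosetExponential.
Variables (S : qrel Y Y) (T : qrel Z Z).
Hypotheses (hS : qorder S) (hT : qorder T).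

(** The analogue of the pointwise comparison of maps: f is below g when y <= y'
implies f y <= g y'. On arbitrary maps it is transitive and antisymmetric, and it
is reflexive exactly at the monotone ones. *)
Definition pointwise : qrel E E := tres S (rcomp (radj ev) (rcomp T ev)).

Lemma pointwise_le G :
  rle G pointwise <-> rle (rcomp ev (rprod G S)) (rcomp T ev).
Proof. by rewrite tresP (qfun_shiftl qev). Qed.

Lemma pointwise_trans : rle (rcomp pointwise pointwise) pointwise.
Proof.
have [S1 _ _] := hS; have [_ T2 _] := hT.
have evN := (pointwise_le pointwise).1 (rle_refl _).
apply/pointwise_le; apply: (@rle_trans _ _ _
    (rcomp ev (rprod (rcomp pointwise pointwise) (rcomp S S)))).
  apply/rcompSr/rprodS; first exact: rle_refl.
  by rewrite -{1}[S]rcomp1l; exact: rcompSl.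
rewrite rprod_comp rcompA; apply: rle_trans (rcompSl _ evN) _.
rewrite -rcompA; apply: rle_trans (rcompSr _ evN) _.
by rewrite rcompA; exact: rcompSl.
Qed.

(** A relation G below N and N^+ satisfies
G x I <= Eval^+ (T meet T^+) Eval = Eval^+ Eval, because pulling back along Eval
preserves meets; so G is below the intertwiners from Eval to itself. *)
Lemma pointwise_antisym : rle (rmeet pointwise (radj pointwise)) (rid E).
Proof.
have [S1 _ _] := hS; have [_ _ T3] := hT.
apply: rle_trans qhom_exponential; set G := rmeet _ _.
have below (G' : qrel E E) : rle G' pointwise ->
    rle (rprod G' (rid Y)) (rcomp (radj ev) (rcomp T ev)).
  by move=> /tresP; apply: rle_trans; apply: rprodS => //; exact: rle_refl.
apply/tresP; rewrite -{2}[ev]rcomp1l -T3.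
apply: rle_trans (pullback_meet _ _ qev); apply: rmeet_le.
  by apply: below; exact: rmeetl.
have -> : rcomp (radj ev) (rcomp (radj T) ev) =
    radj (rcomp (radj ev) (rcomp T ev)) by rewrite !radj_comp radjK rcompA.
apply/radj_le; rewrite radj_prod radj1; apply: below.
by apply/radj_le; exact: rmeetr.
Qed.

Section Restriction.
Variable W : set (atom E).
Let J := qincl W.
Let evW := ev_restr ev W.

Lemma qfun_ev_restr : qfun evW.
Proof. by apply: qfun_comp qev; apply: qfun_prod (qfun_id _); exact: qfun_qincl. Qed.

Lemma ev_restr_comp X X' (G : qrel X (qsub W)) (A : qrel X' Y) :
  rcomp evW (rprod G A) = rcomp ev (rprod (rcomp J G) A).
Proof. by rewrite /evW /ev_restr -rcompA -rprod_comp rcomp1l. Qed.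

Lemma ev_restr_le (G : qrel (qsub W) (qsub W)) :
  rle (rcomp evW (rprod G S)) (rcomp T evW) <->
  rle G (rcomp (radj J) (rcomp pointwise J)).
Proof.
have qJ : qfun J := qfun_qincl W.
have qJI : qfun (rprod J (rid Y)) := qfun_prod qJ (qfun_id Y).
rewrite ev_restr_comp /evW /ev_restr rcompA -(qfun_shiftr qJI).
rewrite radj_prod radj1 -rcompA -rprod_comp rcomp1r -pointwise_le.
by rewrite (qfun_shiftr qJ) (qfun_shiftl qJ).
Qed.

Lemma ev_restr_monotone :
  monotone (rprod (rid (qsub W)) S) T evW <->
  forall w, W w -> \1%VF \in pointwise w w.
Proof.
rewrite -qincl_range -{1}[qincl W]rcomp1r (qfun_shiftr (qfun_qincl W)).
rewrite (qfun_shiftl (qfun_qincl W)) -ev_restr_le.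
by split=> [[]|le] //; split=> //; exact: qfun_ev_restr.
Qed.

Lemma qorder_pointwise : (forall w, W w -> \1%VF \in pointwise w w) ->
  qorder (rcomp (radj J) (rcomp pointwise J)).
Proof.
have qJ : qfun J := qfun_qincl W; move=> W1.
have refl : rle (rid (qsub W)) (rcomp (radj J) (rcomp pointwise J)).
  apply/(qfun_shiftl qJ)/(qfun_shiftr qJ).
  by rewrite rcomp1r; exact/qincl_range.
split=> //.
  apply: rle_trans (pullback_comp _ _ qJ) _.
  by apply/rcompSr/rcompSl; exact: pointwise_trans.
apply: rle_anti; last first.
  apply: rmeet_le => //; apply/radj_le; rewrite radj1; exact: refl.
rewrite !radj_comp radjK -rcompA; apply: rle_trans (pullback_meet _ _ qJ) _.
rewrite -(qincl_isometry W); apply: rcompSr.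
by rewrite -[X in rle _ X]rcomp1l; exact: rcompSl pointwise_antisym.
Qed.

End Restriction.

Definition monotone_points : set (atom E) :=
  [set w | \1%VF \in pointwise w w].

Let W := monotone_points.
Let J := qincl W.
Let evW := ev_restr ev W.
Let Q := rcomp (radj J) (rcomp pointwise J).

Section Transpose.
Variables (X : qset C) (P : qrel X X) (F : qrel (qprod X Y) Z) (G0 : qrel X E).
Hypotheses (hP : qorder P) (mF : monotone (rprod P S) T F) (qG0 : qfun G0)
  (FG0 : F = rcomp ev (rprod G0 (rid Y))).

(** Moving G0^+ and Eval (G0 x I) = F across the inequality leaves the
monotonicity of F. *)
Lemma transpose_pointwise : rle (rcomp (rcomp G0 P) (radj G0)) pointwise.
Proof.
have qGI : qfun (rprod G0 (rid Y)) := qfun_prod qG0 (qfun_id Y).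
apply/pointwise_le.
(* (G0 P G0^+) x S = (G0 x I) (P x S) (G0 x I)^+ *)
rewrite -[S]rcomp1r rprod_comp -[rid Y]radj1 -radj_prod rcompA.
apply/(qfun_shiftr qGI).
rewrite -[S]rcomp1l rprod_comp rcompA -FG0 -rcompA -FG0.
exact: mF.2.
Qed.

(** If g is a nonzero component of G0 at the atom a, then g g^+ is a nonzero scalar
c, because G0 is a function; it lies in G0 P G0^+ <= N, so 1 lies in the
component of N at a, that is, a is in W. *)
Lemma transpose_corestrict : rcomp J (rcomp (radj J) G0) = G0.
Proof.
rewrite rcompA; apply: rle_anti.
  by rewrite -[X in rle _ X]rcomp1l; exact: rcompSl (qfun_qincl W).2.
move=> x a; apply/subvP => g G0g; have [->|g0] := eqVneq g 0; first exact: mem0v.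
have gg : (g \o dag g)%VF \in rcomp G0 (radj G0) a a.
  have dg : dag g \in radj G0 a x by rewrite mem_radj dagK.
  exact: mem_rcomp G0g dg.
have := subvP (qG0.2 a a) _ gg; rewrite rid_refl => /vlineP[c ggc].
have c0 : c != 0.
  apply: contra g0 => /eqP c0; apply/eqP; rewrite -[g]dagK -[RHS]dag0.
  congr dag; apply/lfunP => y; rewrite zero_lfunE; apply: dag_comp_eq0.
  by rewrite dagK -comp_lfunE ggc c0 scale0r zero_lfunE.
have Wa : W a.
  rewrite /W /monotone_points /= -[\1%VF]scale1r -(mulVf c0) -scalerA -ggc.
  rewrite rpredZ //; apply: (subvP (transpose_pointwise a a)).
  apply: (subvP _ _ gg); apply: rcompSl; rewrite -{1}[G0]rcomp1r.
  by apply: rcompSr; case: hP.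
pose w : atom (qsub W) := exist _ a Wa.
have JJ1 : \1%VF \in rcomp J (radj J) a a.
  by move: (a) Wa {w G0g gg ggc}; exact/qincl_range/rle_refl.
by rewrite -[g]comp_lfun1l; exact: mem_rcomp JJ1 G0g.
Qed.

Lemma transpose_monotone : monotone P Q (rcomp (radj J) G0).
Proof.
have qJ : qfun J := qfun_qincl W.
split; first by apply: (@qfun_corestrict _ _ W); rewrite transpose_corestrict.
rewrite /Q -!rcompA transpose_corestrict; apply: rcompSr.
exact/(qfun_shiftr qG0)/transpose_pointwise.
Qed.

End Transpose.

(** Existence and uniqueness of the transpose come from those of G0 in qSet:
composing with J is injective as J^+ J = I. *)
Lemma poset_exponential :
  [/\ qorder Q,
      monotone (rprod Q S) T evW,
      forall (X : qset C) (P : qrel X X), qorder P ->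
        forall F : qrel (qprod X Y) Z, monotone (rprod P S) T F ->
        exists! G : qrel X (qsub W),
          monotone P Q G /\ rcomp evW (rprod G (rid Y)) = F,
      monotone (rprod (rid (qsub W)) S) T evW /\
        (forall W' : set (atom E),
          monotone (rprod (rid (qsub W')) S) T (ev_restr ev W') ->
          (W' `<=` W)%classic) &
      rle (rcomp evW (rprod Q S)) (rcomp T evW) /\
        (forall Q' : qrel (qsub W) (qsub W),
          rle (rcomp evW (rprod Q' S)) (rcomp T evW) ->
          rle Q' Q)].
Proof.
have evQ : rle (rcomp evW (rprod Q S)) (rcomp T evW).
  exact/ev_restr_le/rle_refl.
split.
- by apply: qorder_pointwise.
- by split=> //; exact: qfun_ev_restr.
- move=> X P hP F mF; have [G0 [[qG0 FG0] _]] := exp_ev.2 X F mF.1.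
  exists (rcomp (radj J) G0); split=> [|G [[qG _] FG]].
    split; first exact: (transpose_monotone hP mF).
    by rewrite ev_restr_comp (transpose_corestrict hP mF qG0 FG0).
  rewrite -[G]rcomp1l -(qincl_isometry W) -rcompA; congr rcomp.
  apply: exponential_uniq => //.
    by apply: qfun_comp qG _; exact: qfun_qincl.
  by rewrite -FG0 -FG ev_restr_comp.
- split=> [|W' /ev_restr_monotone]; last by [].
  exact/ev_restr_monotone.
- by split=> // Q' /ev_restr_le.
Qed.

End PosetExponential.
End UniversalEvaluation.

Theorem theorem8p3 (R : realType) (Y Z : qset R[i])
    (S : qrel Y Y) (hS : qorder S) (T : qrel Z Z) (hT : qorder T) :
  (exists (E : qset R[i]) (ev : qrel (qprod E Y) Z), is_exponential ev) /\
  forall (E : qset R[i]) (ev : qrel (qprod E Y) Z), is_exponential ev ->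
  exists (W : set (atom E)) (Q : qrel (qsub W) (qsub W)),
  [/\ qorder Q,
      monotone (rprod Q S) T (ev_restr ev W),
      forall (X : qset R[i]) (P : qrel X X), qorder P ->
        forall F : qrel (qprod X Y) Z, monotone (rprod P S) T F ->
        exists! G : qrel X (qsub W),
          monotone P Q G /\ rcomp (ev_restr ev W) (rprod G (rid Y)) = F,
      monotone (rprod (rid (qsub W)) S) T (ev_restr ev W) /\
        (forall W' : set (atom E),
          monotone (rprod (rid (qsub W')) S) T (ev_restr ev W') ->
          (W' `<=` W)%classic) &
      rle (rcomp (ev_restr ev W) (rprod Q S)) (rcomp T (ev_restr ev W)) /\
        (forall Q' : qrel (qsub W) (qsub W),
          rle (rcomp (ev_restr ev W) (rprod Q' S))
              (rcomp T (ev_restr ev W)) ->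
          rle Q' Q)].
Proof.
split=> [|E ev exp_ev]; first exact: exponential_exists.
exists (monotone_points ev S T); eexists.
exact: (poset_exponential exp_ev hS hT).
Qed.
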